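(* Let $0<\alpha<1$, $\lambda>0$ and $t>0$. The probability density $h_{\alpha,\lambda}(x,t)$ of the inverse tempered stable subordinator $E_{\alpha,\lambda}(t)$ is given, for $x>0$, by the power series representation $$h_{\alpha,\lambda}(x,t)=\sum_{k=0}^{\infty}e^{-\lambda t+\lambda^{\alpha}x}\,\frac{(-x)^{k}\,t^{-\alpha(k+1)}}{k!}\sum_{m=0}^{\infty}\left[\frac{(t\lambda)^{m}}{\Gamma(-\alpha(k+1)+m+1)}-\frac{t^{m}\lambda^{\alpha+m}}{\Gamma(-\alpha k+1+m)}\right].$$
   Context: For $0<\alpha<1$ and $\lambda>0$, the tempered stable subordinator $(D_{\alpha,\lambda}(t))_{t\ge 0}$ is the subordinator (non-decreasing Lévy process started at $0$) with Laplace transform $\mathbb{E}(e^{-sD_{\alpha,\lambda}(t)})=e^{-t((s+\lambda)^{\alpha}-\lambda^{\alpha})}$ for $s>0$. The inverse tempered stable subordinator is its right-continuous inverse $E_{\alpha,\lambda}(t)=\inf\{w>0: D_{\alpha,\lambda}(w)>t\}$, and $h_{\alpha,\lambda}(\cdot,t)$ denotes the density of $E_{\alpha,\lambda}(t)$. $\Gamma$ is the Gamma function, with the convention $1/\Gamma(z)=0$ when $z$ is a non-positive integer.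
   Formalization: In the second inner term the factor t^m is corrected to t^{m+α}; as printed, the series differs from the density by λ^α(1−t^{−α})P(E_{α,λ}(t)>x), so the formula is false for every t≠1, and the two versions agree at t=1. *)

(* Defs.v *)
From HB Require Import structures.
From mathcomp Require Import all_boot all_order all_algebra.
From mathcomp Require Import all_classical all_reals all_analysis.

Set Implicit Arguments.
Unset Strict Implicit.
Unset Printing Implicit Defensive.

Import Order.TTheory GRing.Theory Num.Theory.
Import numFieldNormedType.Exports.

Local Open Scope classical_set_scope.
Local Open Scope ring_scope.

(* Euler's integral; meaningful for 0 < z only. *)
Definition euler_gamma (R : realType) (z : R) : R :=
  \int[lebesgue_measure]_(u in `]0, +oo[%classic) (u `^ (z - 1) * expR (- u)).

(* For z <= 0, Gamma z is given by the functional equation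
   Gamma (z + n) = z (z + 1) ... (z + n - 1) Gamma z,
   with n = |floor z| + 1, so that 0 < z + n. *)
Definition Gamma (R : realType) (z : R) : R :=
  if 0 < z then euler_gamma z
  else let n := `|Num.floor z|%N.+1 in
       euler_gamma (z + n%:R) / \prod_(i < n) (z + i%:R).

Definition recip_Gamma (R : realType) (z : R) : R :=
  if (z \is a Num.int) && (z <= 0) then 0 else (Gamma z)^-1.

(* The process is indexed by R, but only its values at times >= 0 matter. *)

Definition stationary_increments d (T : measurableType d) (R : realType)
    (P : probability T R) (D : R -> {RV P >-> R}) : Prop :=
  forall (u v : R) (B : set R), 0 <= u -> 0 <= v -> measurable B ->
    P [set w | B (D (u + v) w - D u w)] = P [set w | B (D v w - D 0 w)].

(* Taking some of the B i equal to setT gives the product rule for all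
   subfamilies of the increments. *)
Definition independent_increments d (T : measurableType d) (R : realType)
    (P : probability T R) (D : R -> {RV P >-> R}) : Prop :=
  forall (n : nat) (u : nat -> R) (B : nat -> set R),
    0 <= u 0%N -> (forall i, u i <= u i.+1) -> (forall i, measurable (B i)) ->
    P [set w | forall i, (i < n)%N -> B i (D (u i.+1) w - D (u i) w)] =
    (\prod_(i < n) P [set w | B i (D (u i.+1) w - D (u i) w)%R])%E.

(* Left limits of the paths and stochastic continuity are not required
   separately: the former exist by monotonicity, the latter follows from
   right-continuity at 0 and stationarity. *)
Record subordinator d (T : measurableType d) (R : realType)
    (P : probability T R) (D : R -> {RV P >-> R}) : Prop := Subordinator {
  subordinator_start : {ae P, forall w, D 0 w = 0} ;
  subordinator_stationary : stationary_increments D ;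
  subordinator_independent : independent_increments D ;
  subordinator_nondecreasing : {ae P, forall w, forall u v : R,
    0 <= u -> u <= v -> D u w <= D v w} ;
  subordinator_right_continuous : {ae P, forall w, forall u : R,
    0 <= u -> D v w @[v --> u^'+] --> D u w}
}.

Definition tempered_stable_subordinator d (T : measurableType d)
    (R : realType) (P : probability T R) (alpha lambda : R)
    (D : R -> {RV P >-> R}) : Prop :=
  subordinator D /\
  forall u s : R, 0 <= u -> 0 < s ->
    ('E_P[fun w => (expR (- s * D u w))%R] =
     (expR (- u * ((s + lambda) `^ alpha - lambda `^ alpha)))%:E)%E.

(* The infimum is taken in \bar R, where it is +oo if the path never exceeds
   t; a real random variable E satisfying this is a.s. such that the level t
   is passed. *)
Definition inverse_at d (T : measurableType d) (R : realType)
    (P : probability T R) (D : R -> {RV P >-> R}) (t : R) (E : {RV P >-> R})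
    : Prop :=
  {ae P, forall w,
    (E w)%:E = ereal_inf [set u%:E | u in [set u : R | 0 < u /\ t < D u w]]}.

Definition is_density d (T : measurableType d) (R : realType)
    (P : probability T R) (X : {RV P >-> R}) (f : R -> R) : Prop :=
  [/\ measurable_fun setT f, (forall x, 0 <= f x) &
      forall A : set R, measurable A ->
        distribution P X A = (\int[lebesgue_measure]_(x in A) (f x)%:E)%E].

(* The second summand comes from inverting the Laplace transform
   lambda^alpha (s + lambda)^(alpha k) / s in t. Once t^(-alpha (k + 1)) is
   factored out, the power of t left there is t^(m + alpha). With t^m instead,
   as the expansion is sometimes printed, the formula is false for t <> 1. *)
Definition its_inner_term (R : realType) (alpha lambda t : R) (k m : nat) : R :=
  (t * lambda) ^+ m * recip_Gamma (- alpha * k.+1%:R + m%:R + 1)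
  - t `^ (alpha + m%:R) * lambda `^ (alpha + m%:R)
    * recip_Gamma (- alpha * k%:R + 1 + m%:R).

(* Main.v *)
Require Import Defs.
From HB Require Import structures.
From mathcomp Require Import all_boot all_order all_algebra.
From mathcomp Require Import all_classical all_reals all_analysis.
From mathcomp Require Import measurable_realfun.
From mathcomp Require Import ring lra.

(** The density comes from a real-variable inversion of the Laplace transform
    of D x, the Post-Widder method, carried out on distribution functions.

    For a Poisson variable N of mean s v, the probability Q n (s v) that
    N <= n is a partial sum of exp (s v) divided by exp (s v). At
    s = n / t - lambda it tends to 1 if v < t and to 0 if t < v, by Chernoff
    bounds. So every limit of E [Q n (s D x)] lies between P (D x < t) and
    P (D x <= t). This expectation only involves the derivatives of the
    Laplace transform at s, and the transform is a power series in
    (s + lambda)^alpha: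
      exp (- x ((s + lambda)^alpha - lambda^alpha))
        = exp (lambda^alpha x) sum_k (- x)^k / k! (s + lambda)^(alpha k).
    Each power (s + lambda)^K, with K = alpha k, contributes
    (s + lambda)^K B_n (K, q), where q = s / (s + lambda) and B_n (K, q) is
    the n-th Taylor sum of (1 - q)^K ([expectation_poisson_cdf]).

    The Gamma function enters through the limit of one such contribution. With
    p = 1 - q = lambda t / n, a negative binomial expansion
    ([cvg_negative_binomial]) gives
      (1 - p)^-(n+1) B_n (K, 1 - p)
        = sum_m p^m (1 - K + m) (2 - K + m) ... (n - K + m) / n!,
    whose terms, multiplied by n^K, are (lambda t)^m times Gauss's products
    for 1 / Gamma (1 - K + m). Gauss's limit holds at every real argument,
    poles included ([cvg_gauss]), hence [cvg_bsum]: n^K B_n tends to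
    exp (- lambda t) sum_m (lambda t)^m / Gamma (1 - K + m).

    The limit is exchanged with the sum over k by Tannery's theorem. The
    majorant comes from the differential equation satisfied by B_n: it yields
    n^K |B_n| <= (lambda t)^K + exp K (K + 1)^K, and as alpha < 1 the second
    term grows more slowly than k! ([coef_bound_geometric]). The outcome is an
    explicit function [survival], an exponential times a power series in x of
    infinite radius, with
      P (D x < t) <= survival x <= P (D x <= t)   ([survival_sandwich]).

    The tail of E is then found from the paths. If x < u then D u <= t forces
    x < E; if u < x then x < E forces D x <= t, hence D u < t almost surely,
    because an increment over a nondegenerate interval vanishes with
    probability 0. So P (x < E) is at most survival u for u < x and at least
    survival u for u > x, and continuity gives P (x < E) = survival x
    ([tail_survival]). Differentiating survival term by term produces the
    series of the theorem: the two halves of its bracket come from the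
    derivatives of the power series and of the exponential factor. *)

Set Implicit Arguments.
Unset Strict Implicit.
Unset Printing Implicit Defensive.

Import Order.TTheory GRing.Theory Num.Theory.
Import numFieldNormedType.Exports.

Local Open Scope classical_set_scope.
Local Open Scope ring_scope.

(** * Dominated convergence of series *)

Section SeriesTools.
Variable R : realType.
Implicit Types (f : nat -> nat -> R) (g M : nat -> R).

Lemma cvg_series_dom (g M : nat -> R) :
  (forall k, `|g k| <= M k) -> cvgn (series M) -> cvgn (series g).
Proof.
move=> gM cM; apply: normed_cvg.
by apply: (series_le_cvg _ _ gM) => //= n; rewrite (le_trans _ (gM n)).
Qed.

Lemma cvg_geometric_half (M : R) : cvgn (series (geometric M 2^-1)).
Proof. by apply: is_cvg_geometric_series; rewrite ger0_norm ?invr_ge0// invf_lt1// ltr1n. Qed.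

Lemma cvgn_unique (u : nat -> R) (a b : R) :
  u n @[n --> \oo] --> a -> u n @[n --> \oo] --> b -> a = b.
Proof. by move=> ua ub; rewrite -(cvg_lim _ ua)// -(cvg_lim _ ub). Qed.

Lemma cvg_sum_seq (I T : Type) (F : set_system T) (r : seq I)
    (f : I -> T -> R) (l : I -> R) :
  Filter F -> (forall i, f i x @[x --> F] --> l i) ->
  \sum_(i <- r) f i x @[x --> F] --> \sum_(i <- r) l i.
Proof.
move=> FF fl; elim: r => [|i r ih].
  by rewrite big_nil; under eq_cvg do rewrite big_nil; exact: cvg_cst.
by rewrite big_cons; under eq_cvg do rewrite big_cons; apply: cvgD.
Qed.

(** Dominated convergence for the counting measure. The bound is only asked for
    eventually in n, uniformly in k, since the majorants below fail for small n. *)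
Lemma tannery f g M :
  (\forall n \near \oo, forall k, `|f n k| <= M k) -> cvgn (series M) ->
  (forall k, f n k @[n --> \oo] --> g k) ->
  cvgn (series g) /\ limn (series (f n)) @[n --> \oo] --> limn (series g).
Proof.
move=> fM cM fg.
have gM k : `|g k| <= M k.
  have H : `|f n k| @[n --> \oo] --> `|g k| by apply: cvg_norm; exact: fg.
  rewrite -(cvg_lim _ H) //; apply: limr_le; first by apply/cvg_ex; eexists; exact: H.
  by near=> n; move: k {H}; near: n.
have cg := cvg_series_dom gM cM.
split=> //; apply/cvgrPdist_le => e e0.
have M0 k : 0 <= M k by rewrite (le_trans _ (gM k)).
have ndM : nondecreasing_seq (series M).
  by apply/nondecreasing_seqP => n; rewrite seriesSr lerDl.
have /cvgrPdist_le/(_ (e / 4)) : series M @ \oo --> limn (series M) by [].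
(* Beyond N both tails are bounded by that of M, which leaves e / 4 for each;
   the head is a finite sum of convergent sequences and gets e / 2. *)
have e4 : 0 < e / 4 by lra.
move=> /(_ e4) [N _ HN].
have {HN} := HN N (leqnn N); rewrite /= => HN.
have Hsum : \sum_(0 <= k < N) `|g k - f n k| @[n --> \oo] --> (0:R).
  have E : \sum_(0 <= k < N) `|g k - g k| = 0.
    by rewrite big1// => k _; rewrite subrr normr0.
  rewrite -[X in _ --> X]E.
  refine (@cvg_sum_seq _ _ \oo _ (fun k n => `|g k - f n k|)
    (fun k => `|g k - g k|) _ _) => k; apply: cvg_norm; apply: cvgB => //; exact: cvg_cst.
have /cvgrPdist_le/(_ (e / 2)) := Hsum.
have e2 : 0 < e / 2 by lra.
move=> /(_ e2) Hs.
near=> n.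
have fMn : forall k, `|f n k| <= M k by near: n.
have cf := cvg_series_dom fMn cM.
have Hb : `|\sum_(0 <= k < N) `|g k - f n k| | <= e / 2.
  rewrite -normrN -sub0r; near: n; exact: Hs.
rewrite -limB//.
have cB : series g m - series (f n) m @[m --> \oo] --> lim ((series g - series (f n)) @ \oo).
  apply: (is_cvgB cg cf).
have cB' : `|series g m - series (f n) m| @[m --> \oo] --> `|lim ((series g - series (f n)) @ \oo)| by exact: cvg_norm.
rewrite -(cvg_lim _ cB')//; apply: limr_le; first by apply/cvg_ex; eexists; exact: cB'.
near=> m.
have Nm : (N <= m)%N by near: m; exact: nbhs_infty_ge.
rewrite /= /series/= -sumrB (@big_cat_nat _ _ _ N)//=.
apply: (le_trans (ler_normD _ _)).
rewrite (_ : e = e / 2 + e / 2); last lra.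
apply: lerD.
  apply: le_trans Hb; rewrite [leRHS]ger0_norm ?sumr_ge0//.
  exact: ler_norm_sum.
apply: (le_trans (ler_norm_sum _ _ _)).
have : series M m - series M N <= e / 4.
  apply: le_trans HN; rewrite ger0_norm.
    by rewrite lerD2r; apply: nondecreasing_cvgn_le.
  by rewrite subr_ge0; apply: nondecreasing_cvgn_le.
rewrite /series/= [X in X - _](@big_cat_nat _ _ _ N)//= addrAC subrr add0r => HM.
apply: (@le_trans _ _ (\sum_(N <= k < m) (M k + M k))).
  by apply: ler_sum => k _; apply: (le_trans (ler_normB _ _)); exact: lerD.
rewrite big_split/=; lra.
Unshelve. all: by end_near. Qed.

End SeriesTools.

(** * Euler's integral *)

Section GammaIntegral.
Variable R : realType.
Notation mu := (@lebesgue_measure R).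

Lemma integral_derive (f F : R -> R) (a b : R) : a < b ->
  (forall x, a <= x <= b -> is_derive x (1 : R) F (f x)) ->
  (forall x, a <= x <= b -> {for x, continuous f}) ->
  (\int[mu]_(x in `[a, b]) (f x)%:E = (F b - F a)%:E)%E.
Proof.
move=> ab dF cf; rewrite EFinB; apply: continuous_FTC2 => //.
- by apply: continuous_in_subspaceT => x /set_mem/=; rewrite in_itv/=; exact: cf.
- have cF x : a <= x <= b -> {for x, continuous F}.
    move=> xab; apply: differentiable_continuous; apply/derivable1_diffP.
    by have [] := dF x xab.
  split.
  + move=> x; rewrite in_itv/= => /andP[ax xb].
    by have [] := dF x; rewrite ?(ltW ax) ?(ltW xb).
  + by apply: cvg_at_right_filter; apply: cF; rewrite lexx ltW.
  + by apply: cvg_at_left_filter; apply: cF; rewrite lexx ltW.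
- move=> x; rewrite in_itv/= => /andP[ax xb].
  have xab : a <= x <= b by rewrite !ltW.
  by rewrite derive1E; have [_] := dF x xab.
Qed.

Definition gamma_fun (z u : R) := u `^ (z - 1) * expR (- u).

Lemma gamma_fun_ge0 z u : 0 <= gamma_fun z u.
Proof. by rewrite mulr_ge0 ?powR_ge0 ?expR_ge0. Qed.

Lemma measurable_gamma_fun z D : measurable_fun D (gamma_fun z).
Proof.
apply: measurable_funTS; apply: measurable_funM; first exact: measurable_powR.
by apply: measurableT_comp => //; exact: measurableT_comp.
Qed.

Lemma continuous_gamma_fun z u : 0 < u -> {for u, continuous (gamma_fun z)}.
Proof.
move=> u0; apply: differentiable_continuous; apply/derivable1_diffP.
apply: derivableM.
  by have [] := is_derive1_powR (z - 1) u0.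
by [].
Qed.

(** Extended-real valued, so that the functional equation and Young's bound can
    be used to prove finiteness. *)
Definition gammaE (z : R) : \bar R :=
  (\int[mu]_(u in (`]0, +oo[%classic)%R) (gamma_fun z u)%:E)%E.

Lemma gammaE_ge0 z : (0 <= gammaE z)%E.
Proof. by apply: integral_ge0 => u _; rewrite lee_fin gamma_fun_ge0. Qed.

(** Compact intervals inside the open half-line, where integration by parts is
    elementary; the shift by 2 makes them nondegenerate from n = 0 on. *)
Definition exhaust (n : nat) : set R := `[n.+2%:R^-1, n.+2%:R]%classic.

Lemma gammaE_exhaust z :
  (\int[mu]_(u in exhaust n) (gamma_fun z u)%:E)%E @[n --> \oo] --> gammaE z.
Proof.
rewrite /gammaE; have <- : \bigcup_n exhaust n = `]0, +oo[%classic.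
  rewrite eqEsubset; split=> x /=.
    move=> [n _]; rewrite /exhaust/= !in_itv/= andbT => /andP[+ _].
    by apply: lt_le_trans; rewrite invr_gt0 ltr0n.
  rewrite in_itv/= andbT => x0.
  exists (maxn (Num.truncn x) (Num.truncn x^-1)) => //.
  rewrite /exhaust/= in_itv/=.
  have H (y : R) : 0 < y -> y <= (Num.truncn y).+1%:R.
    by move=> y0; rewrite ltW// truncnS_gt.
  apply/andP; split.
    rewrite -[leRHS]invrK lef_pV2 ?posrE ?invr_gt0// ?ltr0n//.
    by rewrite (le_trans (H _ _)) ?invr_gt0// ler_nat ltnS leqW// leq_maxr.
  by rewrite (le_trans (H _ _))// ler_nat ltnS leqW// leq_maxl.
apply: ge0_nondecreasing_set_cvg_integral => //.
- move=> m n mn; rewrite subsetEset => x; rewrite /exhaust/= !in_itv/=.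
  move=> /andP[xm xn]; apply/andP; split.
    by apply: le_trans xm; rewrite lef_pV2 ?posrE ?ltr0n// ler_nat !ltnS.
  by apply: (le_trans xn); rewrite ler_nat !ltnS.
- by move=> i; exact: measurable_itv.
- by move=> i; apply/measurable_EFinP; exact: measurable_gamma_fun.
- by move=> i x _; rewrite lee_fin gamma_fun_ge0.
Qed.

Lemma cvg_powR0 (z : R) : 0 < z -> (n.+2%:R^-1 : R) `^ z @[n --> \oo] --> (0:R).
Proof.
move=> z0; apply/cvgrPdist_le => e e0; near=> n.
rewrite sub0r normrN ger0_norm ?powR_ge0//.
have -> : e = (e `^ z^-1) `^ z by rewrite -powRrM mulVf ?gt_eqF// powRr1// ltW.
rewrite ge0_ler_powR ?nnegrE ?powR_ge0 ?invr_ge0//; first exact: ltW.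
rewrite -[leRHS]invrK lef_pV2 ?posrE ?invr_gt0 ?powR_gt0// ?ltr0n//.
apply: (@le_trans _ _ n%:R); last by rewrite ler_nat leqW.
by near: n; exact: nbhs_infty_ger.
Unshelve. all: by end_near. Qed.

(** The upper boundary term in the integration by parts: raise
    exp (b / (z + 1)) >= b / (z + 1) to the power z + 1. *)
Lemma powR_expRN_le (z b : R) : 0 < z -> 0 < b ->
  b `^ z * expR (- b) <= (z + 1) `^ (z + 1) * b^-1.
Proof.
move=> z0 b0; have z1 : 0 < z + 1 by lra.
have -> : expR (- b) = expR (- (b / (z + 1))) `^ (z + 1).
  by rewrite -expRM; congr expR; field; lra.
have H : expR (- (b / (z + 1))) <= (z + 1) / b.
  rewrite expRN -[leRHS]invrK lef_pV2 ?posrE ?expR_gt0 ?invr_gt0 ?divr_gt0//.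
  by rewrite invf_div (le_trans _ (expR_ge1Dx _))// lerDr.
apply: (@le_trans _ _ (b `^ z * ((z + 1) / b) `^ (z + 1))).
  rewrite ler_wpM2l ?powR_ge0// ge0_ler_powR ?nnegrE ?expR_ge0//; try lra.
  by rewrite divr_ge0//; lra.
rewrite powRM ?invr_ge0 ?(ltW b0)//; last lra.
rewrite mulrCA ler_wpM2l ?powR_ge0// -powR_inv1 ?(ltW b0)// -powRrM.
rewrite -powRD; last by rewrite (gt_eqF b0) implybT.
by have -> : z + -1 * (z + 1) = -1 :> R by lra.
Qed.

(** Integration by parts on the exhausting intervals: the boundary terms [c n]
    vanish in the limit, and monotone convergence does the rest. *)
Lemma gammaE_rec z : 0 < z -> (gammaE (z + 1) = z%:E * gammaE z)%E.
Proof.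
move=> z0.
pose c n : R := (n.+2%:R^-1) `^ z * expR (- n.+2%:R^-1)
   - n.+2%:R `^ z * expR (- n.+2%:R).
have itg y n : mu.-integrable (exhaust n) (EFin \o gamma_fun y).
  apply: continuous_compact_integrable; first exact: segment_compact.
  apply: continuous_in_subspaceT => x /set_mem; rewrite /exhaust/= in_itv/=.
  move=> /andP[+ _] => nx; apply: continuous_gamma_fun.
  by apply: lt_le_trans nx; rewrite invr_gt0 ltr0n.
have E n : (\int[mu]_(u in exhaust n) (gamma_fun (z + 1) u)%:E =
   (c n)%:E + z%:E * \int[mu]_(u in exhaust n) (gamma_fun z u)%:E)%E.
  have n2 : (n.+2%:R^-1 : R) < n.+2%:R.
    apply: (@lt_le_trans _ _ 1); first by rewrite invf_lt1 ?ltr0n// ltr1n.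
    by rewrite ler1n.
  have := @integral_derive (fun u => z * gamma_fun z u - gamma_fun (z + 1) u)
    (fun u => u `^ z * expR (- u)) _ _ n2.
  have -> : (n.+2%:R `^ z * expR (- n.+2%:R) -
    n.+2%:R^-1 `^ z * expR (- n.+2%:R^-1)) = - c n by rewrite /c; ring.
  move=> H.
  have {H} : (\int[mu]_(x in exhaust n)
      (z * gamma_fun z x - gamma_fun (z + 1) x)%:E = (- c n)%:E)%E.
    apply: H => x /andP[nx _].
      have x0 : 0 < x by apply: lt_le_trans nx; rewrite invr_gt0 ltr0n.
      have dz := is_derive1_powR z x0.
      apply: is_derive_eq.
      by rewrite /gamma_fun addrK /GRing.scale/=; ring.
    have x0 : 0 < x by apply: lt_le_trans nx; rewrite invr_gt0 ltr0n.
    apply: (@continuousB _ R^o).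
      by apply: continuousM; [exact: cvg_cst|exact: continuous_gamma_fun].
    exact: continuous_gamma_fun.
  have iz : mu.-integrable (exhaust n) (EFin \o (fun u => z * gamma_fun z u)).
    rewrite (_ : _ \o _ = (fun u => z%:E * (EFin \o gamma_fun z) u)%E)//.
    by apply: integrableZl => //; exact: measurable_itv.
  rewrite integralB_EFin//; last exact: measurable_itv.
  under eq_integral do rewrite EFinM.
  have mA : measurable (exhaust n : set (measurableTypeR R)) by exact: measurable_itv.
  rewrite (integralZl mA (itg z n)).
  have := integrable_fin_num mA (itg (z + 1) n).
  have := integrable_fin_num mA (itg z n).
  rewrite /comp; move: (integral _ _ _) => x; move: (integral _ _ _) => y.
  case: x => // x _; case: y => // y _ /=.
  rewrite -!EFinM -!EFinD => -[e]; congr EFin; lra.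
have : (c n)%:E @[n --> \oo] --> 0%:E.
  apply: cvg_EFin; first by near=> n.
  rewrite (_ : fine \o _ = c)//.
  rewrite -[X in _ --> X](subr0 0); apply: cvgB.
    apply: (@squeeze_cvgr _ _ _ _ (fun=> 0) (fun n => n.+2%:R^-1 `^ z)).
    - near=> n; rewrite mulr_ge0 ?powR_ge0 ?expR_ge0//=.
      rewrite ler_piMr ?powR_ge0// expR_le1 oppr_le0 invr_ge0 ler0n//.
    - exact: cvg_cst.
    - exact: cvg_powR0.
  apply: (@squeeze_cvgr _ _ _ _ (fun=> 0)
     (fun n => (z + 1) `^ (z + 1) * n.+2%:R^-1)).
  - near=> n; rewrite mulr_ge0 ?powR_ge0 ?expR_ge0//=.
    by apply: powR_expRN_le => //; rewrite ltr0n.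
  - exact: cvg_cst.
  - rewrite -[X in _ --> X](mulr0 ((z + 1) `^ (z + 1))).
    apply: cvgMr; under eq_cvg do rewrite -[_^-1]powRr1 ?invr_ge0//.
    exact: cvg_powR0.
move=> c0.
have : (z%:E * \int[mu]_(u in exhaust n) (gamma_fun z u)%:E)%E @[n --> \oo]
   --> (z%:E * gammaE z)%E.
  by apply: cvgeZl => //; exact: gammaE_exhaust.
move=> H.
have := cvgeD _ c0 H.
rewrite add0e => /(_ _ isT) H'.
have H2 := @gammaE_exhaust (z + 1).
apply: (cvg_unique _ H2) => //.
by rewrite /=; under eq_cvg do rewrite E.
Unshelve. all: by end_near. Qed.

Lemma gammaE1 : gammaE 1 = 1%E.
Proof.
have E n : (\int[mu]_(u in exhaust n) (gamma_fun 1 u)%:E =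
   (expR (- n.+2%:R^-1) - expR (- n.+2%:R))%:E)%E.
  have n2 : (n.+2%:R^-1 : R) < n.+2%:R.
    apply: (@lt_le_trans _ _ 1); first by rewrite invf_lt1 ?ltr0n// ltr1n.
    by rewrite ler1n.
  have dF (x : R) : n.+2%:R^-1 <= x <= n.+2%:R ->
      is_derive x (1 : R) (fun u => - expR (- u)) (gamma_fun 1 x).
    move=> _; apply: is_derive_eq.
    by rewrite /gamma_fun subrr powRr0 mul1r mulrN1 opprK.
  rewrite (integral_derive n2 dF).
  - by congr EFin; ring.
  - move=> x /andP[nx _]; apply: continuous_gamma_fun.
    by apply: lt_le_trans nx; rewrite invr_gt0 ltr0n.
have H := @gammaE_exhaust 1; rewrite -(cvg_lim _ H)//.
apply/cvg_lim => //; under eq_cvg do rewrite E.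
apply: cvg_EFin; first by near=> n.
rewrite -[1 in X in _ --> X](subr0 1); apply: cvgB.
  rewrite -[X in _ --> X](expR0).
  apply: continuous_cvg; first exact: continuous_expR.
  rewrite -oppr0; apply: cvgN.
  under eq_cvg do rewrite -[_^-1]powRr1 ?invr_ge0//.
  exact: cvg_powR0.
have := @cvgn_expR R; rewrite -(cvg_shiftn 2) => e0.
by under eq_cvg do rewrite -addn2.
Unshelve. all: by end_near. Qed.

(** Weighted arithmetic-geometric inequality for u / b and 1. The parameter b is
    left free, to be matched to the location of the mass in Euler's integral. *)
Lemma young_powR (z u b : R) : 0 <= z <= 1 -> 0 < u -> 0 < b ->
  u `^ z <= b `^ z * ((1 - z) + z * (u / b)).
Proof.
move=> /andP[z0 z1] u0 b0.
have r0 : 0 < u / b by rewrite divr_gt0.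
rewrite [X in X `^ z](_ : u = b * (u / b)); last by rewrite mulrC divfK// gt_eqF.
rewrite [leLHS](powRM z (ltW b0) (ltW r0)) ler_wpM2l ?powR_ge0//.
move: (u / b) r0 => {u0 b0} r r0; set A : R := _ + _.
have A0 : 0 < A.
  rewrite /A; have [->|zn0] := eqVneq z 0; first lra.
  by rewrite ltr_wpDl ?subr_ge0// mulr_gt0// lt_neqAle eq_sym zn0.
rewrite -ler_ln ?posrE ?powR_gt0// ln_powR.
have H (x : R) : 0 < x -> ln x <= x - 1.
  move=> x0; have := @le_ln1Dx R (x - 1); rewrite subrKC; apply.
  by rewrite ltrBrDr addNr.
have H1 := H _ (divr_gt0 r0 A0).
have H2 := H A^-1; rewrite invr_gt0 in H2; have {}H2 := H2 A0.
rewrite ln_div ?posrE// in H1.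
rewrite lnV ?posrE// in H2.
have : z * (ln r - ln A) + (1 - z) * - ln A <= 0.
  have e : z * (r / A - 1) + (1 - z) * (A^-1 - 1) = 0.
    have -> : z * (r / A - 1) + (1 - z) * (A^-1 - 1) = A / A - 1.
      by rewrite -[X in _ = X / _ - 1]/(1 - z + z * r); ring.
    by rewrite divff ?gt_eqF// subrr.
  by rewrite -e; apply: lerD; apply: ler_wpM2l => //; rewrite subr_ge0.
lra.
Qed.

(** Integrated form of [young_powR], a substitute for the logarithmic convexity
    of Gamma: with b close to y it says that Gamma (y + z) is nearly at most
    y^z Gamma y. *)
Lemma gammaE_young (y z b : R) : 0 <= z <= 1 -> 0 < b ->
  (gammaE (y + z) <= (b `^ z * (1 - z))%:E * gammaE y +
     (b `^ z * (z / b))%:E * gammaE (y + 1))%E.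
Proof.
move=> z01 b0; have [z0 z1] := andP z01.
have c1 : 0 <= b `^ z * (1 - z) by rewrite mulr_ge0 ?powR_ge0// subr_ge0.
have c2 : 0 <= b `^ z * (z / b) by rewrite mulr_ge0 ?powR_ge0// divr_ge0 ?(ltW b0).
have mg (y' : R) : measurable_fun (`]0, +oo[%classic : set R) (EFin \o gamma_fun y').
  by apply/measurable_EFinP; exact: measurable_gamma_fun.
have mE (c y' : R) : measurable_fun (`]0, +oo[%classic : set R)
    (fun u => (c%:E * (gamma_fun y' u)%:E)%E).
  apply/measurable_EFinP/measurable_funM => //; exact: measurable_gamma_fun.
have g0 (y' u : R) : (0 <= (gamma_fun y' u)%:E)%E by rewrite lee_fin gamma_fun_ge0.
rewrite /gammaE -!ge0_integralZl_EFin//; try exact: mg.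
rewrite -ge0_integralD//; try exact: mE; try by move=> u _; rewrite mule_ge0.
apply: ge0_le_integral => //.
- exact: mg.
- by apply: emeasurable_funD; exact: mE.
move=> u /=; rewrite in_itv/= andbT => u0.
rewrite -!EFinM -EFinD lee_fin /gamma_fun addrK.
have -> : u `^ (y + z - 1) = u `^ (y - 1) * u `^ z.
  by rewrite -powRD ?(gt_eqF u0) ?implybT//; congr (_ `^ _); ring.
have -> : u `^ y = u `^ (y - 1) * u.
  by rewrite -[in RHS](powRr1 (ltW u0)) -powRrM mul1r -powRD ?(gt_eqF u0) ?implybT// subrK.
have := young_powR z01 u0 b0.
move/(ler_wpM2l (mulr_ge0 (powR_ge0 u (y - 1)) (expR_ge0 (- u)))) => H.
apply: le_trans (le_trans H _); rewrite le_eqVlt; apply/orP; left; apply/eqP; ring.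
Qed.

(** For z in (0, 1], Young's bound with y = 1 compares Gamma (1 + z) with
    Gamma 1 and Gamma 2, and the functional equation brings the finiteness down
    to z; larger z follow from the functional equation. *)
Lemma gammaE_fin z : 0 < z -> gammaE z \is a fin_num.
Proof.
move=> z0; suff: forall n z, 0 < z -> z <= n.+1%:R -> gammaE z \is a fin_num.
  move=> /(_ (Num.truncn z) z z0); apply.
  by rewrite ltW// truncnS_gt.
elim=> [|n ih] {}z {}z0 zn; last first.
  have [z1|z1] := leP z 1.
    by apply: ih => //; rewrite (le_trans z1)// ler1n.
  have -> : z = (z - 1) + 1 by rewrite subrK.
  rewrite gammaE_rec ?subr_gt0// fin_numM//.
  by rewrite ih ?subr_gt0// lerBlDr natr1.
have : (gammaE (1 + z) < +oo)%E.
  apply: le_lt_trans (@gammaE_young 1 z 1 _ ltr01) _; first by rewrite ltW.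
  by rewrite gammaE_rec// gammaE1 !mule1 -EFinD ltry.
rewrite addrC gammaE_rec// => /[dup] H.
rewrite ge0_fin_numE ?gammaE_ge0//.
move: (gammaE_ge0 z) H; case: (gammaE z) => //.
  by move=> r _ _ _; rewrite ltry.
by rewrite mulry gtr0_sg// mul1e.
Qed.
End GammaIntegral.

(** * Gauss's product and the reciprocal Gamma function *)

Section GaussLimit.
Variable R : realType.

Definition rising (z : R) (n : nat) : R := \prod_(i < n) (z + i%:R).

Lemma rising0 z : rising z 0 = 1.
Proof. by rewrite /rising big_ord0. Qed.

Lemma risingSr z n : rising z n.+1 = rising z n * (z + n%:R).
Proof. by rewrite /rising big_ord_recr. Qed.

Lemma risingSl z n : rising z n.+1 = z * rising (z + 1) n.
Proof.
rewrite /rising big_ord_recl /= addr0; congr (_ * _).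
by apply: eq_bigr => i _; rewrite -addrA nat1r.
Qed.

Lemma euler_gammaE (z : R) : euler_gamma z = fine (gammaE z).
Proof. by []. Qed.

Lemma euler_gamma_rec (z : R) : 0 < z -> euler_gamma (z + 1) = z * euler_gamma z.
Proof. by move=> z0; rewrite !euler_gammaE gammaE_rec// fineM// gammaE_fin. Qed.

Lemma euler_gamma_rising (z : R) n :
  0 < z -> euler_gamma (z + n%:R) = rising z n * euler_gamma z.
Proof.
move=> z0; elim: n => [|n ih]; first by rewrite addr0 rising0 mul1r.
have zn : 0 < z + n%:R by rewrite ltr_wpDr.
rewrite -natr1 addrA.
rewrite (euler_gamma_rec zn).
rewrite ih risingSr.
by rewrite mulrA [_ * rising z n]mulrC.
Qed.

Lemma euler_gamma_nat n : euler_gamma (n.+1%:R : R) = n`!%:R.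
Proof.
elim: n => [|n ih]; first by rewrite euler_gammaE gammaE1.
by rewrite -natr1 euler_gamma_rec ?ltr0n// ih factS natrM.
Qed.

Lemma euler_gamma_young (y z b : R) : 0 < y -> 0 <= z <= 1 -> 0 < b ->
  euler_gamma (y + z) <= b `^ z * ((1 - z) + z * (y / b)) * euler_gamma y.
Proof.
move=> y0 z01 b0; have := gammaE_young y z01 b0.
have y1 : 0 < y + 1 by rewrite addr_gt0.
have yz : 0 < y + z by case/andP: z01 => z0 _; rewrite ltr_pwDl.
rewrite -[gammaE y]fineK ?gammaE_fin// -[gammaE (y + 1)]fineK ?gammaE_fin//.
rewrite -[gammaE (y + z)]fineK ?gammaE_fin// -!EFinM -EFinD lee_fin.
rewrite -!euler_gammaE euler_gamma_rec// => /le_trans; apply.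
rewrite le_eqVlt; apply/orP; left; apply/eqP; ring.
Qed.

(** Gauss's approximation of 1 / Gamma z. The product has n factors instead of
    the customary n + 1; the missing z + n is accounted for by the exponent
    1 - z in place of - z. *)
Definition gauss (z : R) (n : nat) : R :=
  rising z n * n%:R `^ (1 - z) / n`!%:R.

(** The functional equation of Gamma at finite n, up to the factor
    n / (z + n): it transports the limit between z and z + 1 in both
    directions. *)
Lemma gauss_rec (z : R) n :
  (z + n.+1%:R) * gauss z n.+1 = z * n.+1%:R * gauss (z + 1) n.+1.
Proof.
rewrite /gauss.
have -> : n.+1%:R `^ (1 - z) = n.+1%:R `^ (1 - (z + 1)) * n.+1%:R :> R.
  rewrite -[X in _ = _ * X](powRr1 (ler0n R n.+1)) -powRD ?pnatr_eq0 ?implybT//.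
  by congr (_ `^ _); ring.
have -> : (z + n.+1%:R) * (rising z n.+1 * (n.+1%:R `^ (1 - (z + 1)) * n.+1%:R) / (n.+1)`!%:R)
  = (rising z n.+1 * (z + n.+1%:R)) * (n.+1%:R `^ (1 - (z + 1)) * n.+1%:R) / (n.+1)`!%:R by ring.
rewrite -risingSr risingSl; ring.
Qed.

Lemma cvg_ratio (z : R) : (n.+1%:R / (z + n.+1%:R)) @[n --> \oo] --> (1 : R).
Proof.
have : (1 + z / n.+1%:R)^-1 @[n --> \oo] --> (1 : R).
  rewrite -[X in _ --> X]invr1; apply: cvgV; first exact: oner_neq0.
  rewrite -[X in _ --> X](addr0 1); apply: cvgD; first exact: cvg_cst.
  rewrite -(mulr0 z); apply: cvgMr; exact: cvg_harmonic.
apply: cvg_trans; apply: near_eq_cvg; near=> n.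
have zn : 0 < z + n.+1%:R.
  rewrite -ltrBlDl sub0r (@lt_le_trans _ _ n%:R) ?ler_nat//.
  by near: n; exact: nbhs_infty_gtr.
by rewrite -[in RHS]invf_div mulrDl divff ?pnatr_eq0// addrC.
Unshelve. all: by end_near. Qed.

Lemma cvg_gaussS (z L : R) :
  gauss (z + 1) n @[n --> \oo] --> L -> gauss z n @[n --> \oo] --> z * L.
Proof.
rewrite -(cvg_shiftS (gauss (z + 1))) -(cvg_shiftS (gauss z)) => H.
have : z * (n.+1%:R / (z + n.+1%:R) * gauss (z + 1) n.+1) @[n --> \oo] --> z * (1 * L).
  by apply: cvgM; [exact: cvg_cst|apply: cvgM => //; exact: cvg_ratio].
rewrite mul1r; apply: cvg_trans; apply: near_eq_cvg; near=> n.
have zn : 0 < z + n.+1%:R.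
  rewrite -ltrBlDl sub0r (@lt_le_trans _ _ n%:R) ?ler_nat//.
  by near: n; exact: nbhs_infty_gtr.
apply: (@mulfI _ (z + n.+1%:R)); first by rewrite gt_eqF.
by rewrite gauss_rec /=; move: (n.+1%:R : R) zn => a zn; field; rewrite gt_eqF.
Unshelve. all: by end_near. Qed.

Lemma cvg_gaussP (z L : R) : 0 < z ->
  gauss z n @[n --> \oo] --> L -> gauss (z + 1) n @[n --> \oo] --> L / z.
Proof.
move=> z0; rewrite -(cvg_shiftS (gauss (z + 1))) -(cvg_shiftS (gauss z)) => H.
have z10 : (1 : R) != 0 by exact: oner_neq0.
have : gauss z n.+1 * (n.+1%:R / (z + n.+1%:R))^-1 * z^-1 @[n --> \oo] --> L * 1^-1 * z^-1.
  apply: cvgM; last exact: cvg_cst.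
  by apply: cvgM => //; apply: cvgV => //; exact: cvg_ratio.
rewrite invr1 mulr1; apply: cvg_trans; apply: near_eq_cvg; near=> n.
have zn : z + n.+1%:R != 0 by rewrite gt_eqF// addr_gt0.
rewrite /= invf_div.
apply: (@mulfI _ (z * n.+1%:R)); first by rewrite mulf_neq0 ?gt_eqF.
rewrite -gauss_rec; have : n.+1%:R != 0 :> R by [].
move: (n.+1%:R : R) zn => a zn a0; field; rewrite a0 gt_eqF//.
Unshelve. all: by end_near. Qed.

(** The product of [gauss] with Gamma z is Gamma (n + z) / (n! n^(z - 1)).
    Young's bound from n + 1 to n + 1 + z shows that it is at most 1, and from
    n + 1 + z to n + 2 that it is at least (n + 1) / (z + n + 1). *)
Lemma cvg_gauss_le1 (z : R) : 0 < z -> z <= 1 ->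
  gauss z n @[n --> \oo] --> (euler_gamma z)^-1.
Proof.
move=> z0 z1.
pose r n := gauss z n * euler_gamma z.
have rE n : r n.+1 = euler_gamma (n.+1%:R + z) / (n`!%:R * n.+1%:R `^ z).
  rewrite /r addrC euler_gamma_rising// /gauss powRB ?pnatr_eq0 ?implybT//.
  rewrite powRr1// factS natrM; field.
  by rewrite nat1r !pnatr_eq0 -lt0n fact_gt0 gt_eqF ?powR_gt0.
have z01 : 0 <= z <= 1 by rewrite ltW.
have D n : 0 < n`!%:R * n.+1%:R `^ z :> R.
  by rewrite mulr_gt0 ?powR_gt0// ltr0n fact_gt0.
have r1 n : r n.+1 <= 1.
  rewrite rE ler_pdivrMr// mul1r.
  apply: le_trans (@euler_gamma_young n.+1%:R z n.+1%:R _ z01 _) _ => //.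
  by rewrite divff ?pnatr_eq0// mulr1 subrK mulr1 euler_gamma_nat mulrC.
have r2 n : n.+1%:R / (z + n.+1%:R) <= r n.+1.
  have zn : 0 < z + n.+1%:R by rewrite addr_gt0.
  have := @euler_gamma_young (n.+1%:R + z) (1 - z) (z + n.+1%:R).
  rewrite [n.+1%:R + z]addrC divff ?gt_eqF// mulr1 subrK mulr1 => /(_ zn) H.
  have {H} := H _ zn; rewrite subr_ge0 z1/= gerBl ltW// => /(_ isT).
  have -> : z + n.+1%:R + (1 - z) = n.+2%:R by rewrite -(natr1 n.+1); ring.
  rewrite euler_gamma_nat rE => H.
  rewrite ler_pdivlMr// [n.+1%:R + z]addrC mulrAC ler_pdivrMr//.
  have H2 : n.+1%:R `^ z <= (z + n.+1%:R) `^ z.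
    by rewrite ge0_ler_powR ?nnegrE ?(ltW zn) ?(ltW z0)// lerDr ltW.
  have -> : euler_gamma (z + n.+1%:R) * (z + n.+1%:R) =
     (z + n.+1%:R) `^ (1 - z) * euler_gamma (z + n.+1%:R) * (z + n.+1%:R) `^ z.
    rewrite mulrAC -powRD ?(gt_eqF zn) ?implybT// subrK powRr1 ?(ltW zn)//.
    by rewrite mulrC.
  have -> : n.+1%:R * (n`!%:R * n.+1%:R `^ z) = (n.+1)`!%:R * n.+1%:R `^ z :> R.
    by rewrite factS natrM mulrA.
  by apply: ler_pM; rewrite ?powR_ge0.
have r_cvg : r n.+1 @[n --> \oo] --> (1 : R).
  apply: (@squeeze_cvgr _ _ _ _ (fun n => n.+1%:R / (z + n.+1%:R)) (fun=> 1)).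
  - by near=> n; rewrite r2 r1.
  - exact: cvg_ratio.
  - exact: cvg_cst.
have e0 : euler_gamma z != 0.
  apply/eqP => e0.
  have : r n.+1 @[n --> \oo] --> (0 : R).
    rewrite /r e0; under eq_cvg do rewrite mulr0; exact: cvg_cst.
  by move=> /(cvgn_unique r_cvg)/eqP; rewrite oner_eq0.
rewrite -[X in _ --> X]mul1r -(cvg_shiftS (gauss z)).
have : r n.+1 * (euler_gamma z)^-1 @[n --> \oo] --> 1 * (euler_gamma z)^-1.
  by apply: cvgM => //; exact: cvg_cst.
apply: cvg_trans; apply: near_eq_cvg; near=> n.
by rewrite /= /r mulfK.
Unshelve. all: by end_near. Qed.

Lemma cvg_gauss_gt0 (z : R) : 0 < z ->
  gauss z n @[n --> \oo] --> (euler_gamma z)^-1.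
Proof.
move=> z0; suff: forall n z, 0 < z -> z <= n.+1%:R ->
    gauss z n @[n --> \oo] --> (euler_gamma z)^-1.
  move=> /(_ (Num.truncn z) z z0); apply.
  by rewrite ltW// truncnS_gt.
elim=> [|n ih] {}z {}z0 zn; first exact: cvg_gauss_le1.
have [z1|z1] := leP z 1; first exact: cvg_gauss_le1.
have z10 : 0 < z - 1 by rewrite subr_gt0.
have -> : z = (z - 1) + 1 by rewrite subrK.
rewrite euler_gamma_rec// invfM mulrC; apply: cvg_gaussP => //.
by apply: ih => //; rewrite lerBlDr natr1.
Qed.

(** At a nonpositive integer the rising product contains the factor 0, which
    agrees with the convention for 1 / Gamma at the poles. *)
Lemma recip_GammaE (z : R) : z <= 0 ->
  recip_Gamma z = rising z `|Num.floor z|.+1 / euler_gamma (z + `|Num.floor z|.+1%:R).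
Proof.
move=> z0; rewrite /recip_Gamma /Gamma ltNge z0 andbT /=.
case: ifPn => [zi|_]; last by rewrite invf_div.
rewrite /rising (bigD1 (inord `|Num.floor z|%N))//= inordK//.
have -> : z + `|Num.floor z|%N%:R = 0; last by rewrite !mul0r.
have fz : (Num.floor z)%:~R = z by rewrite floorK.
rewrite natr_absz ler0_norm; last by rewrite -(ler_int R) fz.
by rewrite intrN fz subrr.
Qed.

(** From (0, +oo), where the limit is known, the functional equation carries it
    down to every real z; no division occurs in that direction, so the poles
    need no separate treatment. *)
Lemma cvg_gauss (z : R) : gauss z n @[n --> \oo] --> recip_Gamma z.
Proof.
have [z0|z0] := leP z 0; last first.
  by rewrite /recip_Gamma leNgt z0 andbF /Gamma z0; exact: cvg_gauss_gt0.
rewrite recip_GammaE//; set N := _.+1.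
have zN : 0 < z + N%:R.
  have f0 : Num.floor z <= 0 by rewrite floor_le0 (le_lt_trans z0).
  rewrite /N -natr1 natr_absz (ler0_norm f0) intrN.
  have := ge_floor z; lra.
have := cvg_gauss_gt0 zN; move: (euler_gamma _)^-1 => L.
move: N {zN z0} => N; elim: N z => [|N ih] z.
  by rewrite addr0 rising0 mul1r.
rewrite -natr1 addrA addrAC => /ih/cvg_gaussS; rewrite mulrA.
by rewrite risingSl.
Qed.

End GaussLimit.

(** * Truncated binomial series and their growth *)

Section Coefficients.
Variable R : realType.

Lemma is_derive_le (g dg : R -> R) (a b : R) : a <= b ->
  (forall x, a <= x <= b -> is_derive x (1 : R) g (dg x)) ->
  (forall x, a <= x <= b -> 0 <= dg x) -> g a <= g b.
Proof.
move=> ab dgP dg0.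
have cg : {within `[a, b], continuous g}.
  apply: continuous_in_subspaceT => x /set_mem/=; rewrite in_itv/= => xab.
  apply: differentiable_continuous; apply/derivable1_diffP.
  by have [] := dgP x xab.
have dg' x : x \in `]a, b[%R -> is_derive x (1 : R) g (dg x).
  by rewrite in_itv/= => /andP[ax xb]; apply: dgP; rewrite !ltW.
have [c + E] := MVT_segment ab dg' cg.
rewrite in_itv/= => cab.
by rewrite -subr_ge0 E mulr_ge0 ?dg0// subr_ge0.
Qed.

Lemma exp_term_le (x : R) n : 0 <= x -> x ^+ n / n`!%:R <= expR x.
Proof.
move=> x0.
have nd : nondecreasing_seq (series (exp_coeff x)).
  by apply/nondecreasing_seqP => m; rewrite seriesSr lerDl exp_coeff_ge0.
have := nondecreasing_cvgn_le nd (is_cvg_series_exp_coeff x) n.+1.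
apply: le_trans; rewrite seriesSr lerDr /series/= sumr_ge0// => i _.
exact: exp_coeff_ge0.
Qed.

(** The coefficient of q^j in (1 - q)^K. *)
Definition bcoef (K : R) (j : nat) : R := rising (- K) j / j`!%:R.
Definition bsum (K q : R) (n : nat) : R := \sum_(j < n.+1) bcoef K j * q ^+ j.
(** The value of [bsum K q n] at q = 1, which is what keeps [bsum] from solving
    the differential equation of (1 - q)^K, see [bsum_ode]. *)
Definition bres (K : R) (n : nat) : R := rising (1 - K) n / n`!%:R.

Lemma bcoef0 K : bcoef K 0 = 1.
Proof. by rewrite /bcoef rising0 divr1. Qed.

Lemma bresS K n : n.+1%:R * bres K n.+1 = (n.+1%:R - K) * bres K n.
Proof.
rewrite /bres risingSr factS natrM.
have -> : 1 - K + n%:R = n.+1%:R - K by rewrite -natr1; ring.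
have f0 : n`!%:R != 0 :> R by rewrite pnatr_eq0 -lt0n fact_gt0.
have j0 : n.+1%:R != 0 :> R by rewrite pnatr_eq0.
move: (n.+1%:R : R) j0 (n`!%:R : R) f0 => a a0 c c0.
by field; rewrite a0 c0.
Qed.

Lemma bcoef_bres K n : n.+1%:R * bcoef K n.+1 = - K * bres K n.
Proof.
rewrite /bcoef /bres risingSl factS natrM [- K + 1]addrC.
have f0 : n`!%:R != 0 :> R by rewrite pnatr_eq0 -lt0n fact_gt0.
have j0 : n.+1%:R != 0 :> R by rewrite pnatr_eq0.
move: (n.+1%:R : R) j0 (n`!%:R : R) f0 => a a0 c c0.
by field; rewrite a0 c0.
Qed.

Lemma bsumS K q n : bsum K q n.+1 = bsum K q n + bcoef K n.+1 * q ^+ n.+1.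
Proof. by rewrite /bsum big_ord_recr. Qed.

Definition dbsum (K q : R) (n : nat) : R :=
  \sum_(j < n) j.+1%:R * bcoef K j.+1 * q ^+ j.

Lemma is_derive_bsum K n (q : R) :
  is_derive q (1 : R) (fun v => bsum K v n) (dbsum K q n).
Proof.
elim: n => [|n ih].
  rewrite /dbsum big_ord0 (_ : (fun v => _) = cst (1 : R)); last first.
    by apply/funext => v; rewrite /bsum big_ord1 bcoef0 mul1r.
  exact: is_derive_cst.
rewrite (_ : (fun v => _) = (fun v => bsum K v n) \+ (fun v => bcoef K n.+1 * v ^+ n.+1)).
  rewrite /dbsum big_ord_recr/=.
  apply: is_deriveD.
  have dX : is_derive q (1 : R) (fun v : R => v ^+ n.+1) (n.+1%:R * q ^+ n).
    have := is_deriveX n.+1 (@is_derive_id _ R q 1).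
    by rewrite exprfctE /GRing.scale/= mulr1.
  apply: is_derive_eq.
  by rewrite /GRing.scale/=; ring.
by apply/funext => v; rewrite bsumS.
Qed.

Lemma bsum_ode K n (q : R) :
  (1 - q) * dbsum K q n + K * bsum K q n = K * bres K n * q ^+ n.
Proof.
elim: n => [|n ih].
  rewrite /dbsum /bsum big_ord0 big_ord1 bcoef0 /bres rising0 divr1 !expr0; ring.
rewrite /dbsum big_ord_recr/= -/(dbsum K q n) bsumS.
have e2 : K * bres K n.+1 = (K - n.+1%:R) * bcoef K n.+1.
  apply: (@mulfI _ n.+1%:R) => //.
  have := bresS K n; have := bcoef_bres K n.
  move: (n.+1%:R : R) (bres _ _) (bcoef _ _) (bres _ _) => a x y w e f.
  have -> : a * (K * x) = K * (a * x) by ring.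
  have -> : a * ((K - a) * y) = (K - a) * (a * y) by ring.
  by rewrite e f; ring.
rewrite e2.
have -> : (1 - q) * (dbsum K q n + n.+1%:R * bcoef K n.+1 * q ^+ n) +
  K * (bsum K q n + bcoef K n.+1 * q ^+ n.+1) =
  ((1 - q) * dbsum K q n + K * bsum K q n) +
   ((1 - q) * (n.+1%:R * bcoef K n.+1 * q ^+ n) + K * (bcoef K n.+1 * q ^+ n.+1)).
  ring.
rewrite ih exprS.
have -> : K * bres K n = - (n.+1%:R * bcoef K n.+1) by rewrite bcoef_bres mulNr opprK.
ring.
Qed.

(** By [bsum_ode] the derivative of bsum (1 - q)^(- K) is
    K bres q^n (1 - q)^(- K - 1), in absolute value at most |bres| times the
    derivative of (1 - q)^(- K). Comparing the two between 0 and q gives the bound, uniformly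
    in q, although bsum is an alternating sum of large terms when K is large. *)
Lemma bsum_le (K : R) n (q : R) : 0 <= K -> 0 <= q < 1 ->
  `|bsum K q n| <= (1 - q) `^ K + `|bres K n|.
Proof.
move=> K0 /andP[q0 q1].
have p0 : 0 < 1 - q by rewrite subr_gt0.
(* The two signs of e give the two bounds; [g] is nondecreasing and
   g 0 >= - 1. *)
have main (e : R) : `|e| = 1 ->
    - (1 - q) `^ K - `|bres K n| <= e * bsum K q n.
  move=> e1.
  pose g v := (`|bres K n| + e * bsum K v n) * (1 - v) `^ (- K).
  pose dg v := K * (1 - v) `^ (- K - 1) * (`|bres K n| + e * (bres K n * v ^+ n)).
  have dgP x : 0 <= x <= q -> is_derive x (1 : R) g (dg x).
    move=> /andP[x0 xq].
    have x1 : 0 < 1 - x by rewrite subr_gt0 (le_lt_trans xq).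
    have d1 := is_derive_bsum K n x.
    have d2 : is_derive x (1 : R) (fun v => (1 - v) `^ (- K))
        (- K * (1 - x) `^ (- K - 1) * -1).
      have d3 := is_derive1_powR (- K) x1.
      apply: (@is_derive1_comp R (fun u => u `^ (- K)) (fun v => 1 - v)).
      by apply: is_derive_eq; rewrite add0r mul1r.
    apply: is_derive_eq.
    have E := bsum_ode K n x.
    have -> : (1 - x) `^ (- K) = (1 - x) * (1 - x) `^ (- K - 1).
      by rewrite -{2}(powRr1 (ltW x1)) -powRD ?(gt_eqF x1) ?implybT// subrKC.
    rewrite /dg /GRing.scale/=.
    have -> : K * (1 - x) `^ (- K - 1) * (`|bres K n| + e * (bres K n * x ^+ n)) =
      (1 - x) `^ (- K - 1) * (K * `|bres K n| + e * (K * bres K n * x ^+ n)) by ring.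
    rewrite -E; ring.
  have := @is_derive_le g dg 0 q q0 dgP.
  have -> : g 0 = `|bres K n| + e.
    rewrite /g subr0 powR1 mulr1; congr (_ + _).
    rewrite /bsum big_ord_recl/= expr0 bcoef0 mulr1 big1 ?addr0 ?mulr1// => i _.
    by rewrite expr0n/= mulr0.
  have H : forall x, 0 <= x <= q -> 0 <= dg x.
    move=> x /andP[x0 xq]; rewrite /dg mulr_ge0 ?mulr_ge0 ?powR_ge0//.
    rewrite -lerBlDr sub0r.
    have : `|e * (bres K n * x ^+ n)| <= `|bres K n|.
      rewrite !normrM e1 mul1r ler_piMr// normrX exprn_ile1//.
      by rewrite ger0_norm// ltW// (le_lt_trans xq).
    by rewrite ler_norml lerNl => /andP[].
  move=> /(_ H); rewrite /g powRN => Hg.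
  have pK : 0 < (1 - q) `^ K by rewrite powR_gt0.
  move: Hg; rewrite ler_pdivlMr// => Hg.
  have p1 : (1 - q) `^ K <= 1.
    rewrite -[leRHS](powRr0 (1 - q)) ger_powR// p0/=; lra.
  have en : - 1 <= e by have : `|e| <= 1 by [rewrite e1]; rewrite ler_norml => /andP[].
  have : - (1 - q) `^ K <= (`|bres K n| + e) * (1 - q) `^ K.
    rewrite -mulN1r ler_wpM2r ?(ltW pK)//.
    by have := normr_ge0 (bres K n); lra.
  by lra.
have H1 := main 1 (normr1 _).
have H2 := main (- 1) (normrN1 _).
rewrite ler_norml; apply/andP; split; lra.
Qed.

(** Passing from n to n + 1 multiplies bres by 1 - K / (n + 1). As long as n
    stays below K, this only gives |bres| <= K^n / n! <= exp K. Beyond K the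
    factor is at most exp (- K / (n + 1)) <= (1 + 1 / (n + 1))^(- K), so that
    (n + 1)^K |bres| no longer increases. *)
Lemma bres_le (K : R) n : 0 <= K ->
  n.+1%:R `^ K * `|bres K n| <= expR K * (K + 1) `^ K.
Proof.
move=> K0.
have small m : m%:R <= K -> `|bres K m| <= expR K.
  move=> mK; apply: le_trans (exp_term_le m K0).
  rewrite /bres normrM normfV [`|m`!%:R|]ger0_norm//.
  rewrite ler_wpM2r ?invr_ge0//.
  rewrite /rising normr_prod -[m in leRHS]card_ord -prodr_const.
  apply: ler_prod => i _; rewrite normr_ge0/=.
  have im : i.+1%:R <= K by apply: le_trans mK; rewrite ler_nat.
  have -> : 1 - K + i%:R = i.+1%:R - K by rewrite -natr1; ring.
  have := ler0n R i.+1; rewrite ler0_norm ?subr_le0//; lra.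
elim: n => [|n ih].
  rewrite powR1 mul1r /bres rising0 divr1 normr1 -[leLHS]mulr1.
  apply: ler_pM => //; first by rewrite -expR0 ler_expR.
  by rewrite -[leLHS](powRr0 (K + 1)) ler_powR// lerDr.
have [nK|Kn] := leP n.+1%:R K.
  rewrite mulrC; apply: ler_pM; rewrite ?powR_ge0 ?small//.
  rewrite ge0_ler_powR ?nnegrE//; first by rewrite addr_ge0.
  by rewrite -natr1 lerD2r.
apply: le_trans ih.
have n0 : 0 < n.+1%:R :> R by [].
have -> : bres K n.+1 = (1 - K / n.+1%:R) * bres K n.
  apply: (@mulfI _ n.+1%:R); first exact: lt0r_neq0.
  rewrite bresS; move: (n.+1%:R : R) n0 (bres _ _) => a a0 c; field.
  exact: lt0r_neq0.
have c0 : 0 <= 1 - K / n.+1%:R by rewrite subr_ge0 ler_pdivrMr// mul1r ltW.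
rewrite normrM (ger0_norm c0) mulrA ler_wpM2r//.
have -> : n.+2%:R = n.+1%:R * (1 + n.+1%:R^-1) :> R.
  by rewrite mulrDr mulr1 divff ?lt0r_neq0// natr1.
have i0 : 0 <= n.+1%:R^-1 :> R by rewrite invr_ge0.
rewrite powRM ?addr_ge0// -mulrA ler_piMr ?powR_ge0//.
apply: (@le_trans _ _ (expR (n.+1%:R^-1) `^ K * expR (- (K / n.+1%:R)))).
  apply: ler_pM; rewrite ?powR_ge0//.
  - by rewrite ge0_ler_powR ?nnegrE ?addr_ge0 ?expR_ge0// expR_ge1Dx.
  - exact: expR_ge1Dx.
by rewrite -expRM -expRD mulrC subrr expR0.
Qed.

(** With A^d = 2 C the left side is (A^k / k!)^d 2^-k, and A^k / k! <= exp A. *)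
Lemma expr_fact_powR_geometric (C d : R) : 0 < C -> 0 < d ->
  exists M, forall k, C ^+ k * k`!%:R `^ (- d) <= M * 2^-1 ^+ k.
Proof.
move=> C0 d0.
have C2 : 0 < 2 * C by rewrite mulr_gt0.
pose A := (2 * C) `^ d^-1.
have A0 : 0 < A by rewrite powR_gt0.
exists (expR A `^ d) => k.
have f0 : 0 < k`!%:R :> R by rewrite ltr0n fact_gt0.
have -> : C ^+ k * k`!%:R `^ (- d) = (A ^+ k / k`!%:R) `^ d * 2^-1 ^+ k.
  rewrite powRM ?exprn_ge0 ?invr_ge0 ?ltW//.
  rewrite -[k`!%:R^-1]powR_inv1 ?ltW// -powRrM mulN1r.
  have Ad : A `^ d = 2 * C.
    by rewrite /A -powRrM mulVf ?gt_eqF// powRr1// ltW.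
  rewrite -[A ^+ k]powR_mulrn ?(ltW A0)// powRAC Ad powR_mulrn ?(ltW C2)// mulrAC; congr (_ * _).
  by rewrite -exprMn; congr (_ ^+ _); field.
rewrite ler_wpM2r ?exprn_ge0 ?invr_ge0//.
have Ak : A ^+ k / k`!%:R <= expR A by rewrite exp_term_le ?(ltW A0).
have Ak0 : 0 <= A ^+ k / k`!%:R by rewrite divr_ge0 ?exprn_ge0 ?(ltW A0).
by rewrite ge0_ler_powR ?nnegrE ?expR_ge0 ?(ltW d0).
Qed.

Lemma expr_fact_geometric (C : R) : 0 <= C ->
  exists M, forall k, C ^+ k / k`!%:R <= M * 2^-1 ^+ k.
Proof.
move=> C0; exists (expR (2 * C)) => k.
have -> : C ^+ k / k`!%:R = (2 * C) ^+ k / k`!%:R * 2^-1 ^+ k.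
  by rewrite mulrAC -exprMn; congr (_ ^+ _ / _); field.
by rewrite ler_wpM2r ?exprn_ge0 ?invr_ge0// exp_term_le ?mulr_ge0.
Qed.

(** A bound for n^K |bsum K (1 - y / n) n| valid for all large n, with
    K = alpha k, see [bsum_coef_bound]. *)
Definition coef_bound (alpha y : R) (k : nat) : R :=
  y `^ (alpha * k%:R)
  + expR (alpha * k%:R) * (alpha * k%:R + 1) `^ (alpha * k%:R).

(** Here alpha < 1 is decisive: (K + 1)^K <= (k + 1)^(alpha k) is at most
    of order (C^k k!)^alpha, so a factor k!^(alpha - 1) remains. *)
Lemma coef_bound_geometric (alpha y C : R) :
  0 < alpha < 1 -> 0 <= y -> 0 < C ->
  exists M, forall k, C ^+ k / k`!%:R * coef_bound alpha y k <= M * 2^-1 ^+ k.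
Proof.
move=> /andP[a0 a1] y0 C0.
have [M1 H1] := @expr_fact_geometric (C * y `^ alpha) (mulr_ge0 (ltW C0) (powR_ge0 _ _)).
have d0 : 0 < 1 - alpha by rewrite subr_gt0.
have [M2 H2] := @expr_fact_powR_geometric (C * expR (alpha + alpha)) _ (mulr_gt0 C0 (expR_gt0 _)) d0.
exists (M1 + expR alpha * M2) => k.
rewrite /coef_bound mulrDr mulrDl; apply: lerD.
  apply: le_trans (H1 k).
  by rewrite exprMn powRrM powR_mulrn ?powR_ge0// mulrAC.
have f0 : 0 < k`!%:R :> R by rewrite ltr0n fact_gt0.
apply: (@le_trans _ _ (expR alpha * ((C * expR (alpha + alpha)) ^+ k * k`!%:R `^ (- (1 - alpha))))); last first.
  by rewrite -mulrA ler_wpM2l ?expR_ge0.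
have k1 : 0 < k.+1%:R :> R by [].
have ka : 0 <= alpha * k%:R by rewrite mulr_ge0// ltW.
have B1 : (alpha * k%:R + 1) `^ (alpha * k%:R) <= (expR k.+1%:R * k`!%:R) `^ alpha.
  apply: (@le_trans _ _ (k.+1%:R `^ (alpha * k%:R))).
    rewrite ge0_ler_powR ?nnegrE//; first by rewrite addr_ge0.
    by rewrite -natr1 lerD2r ler_piMl// ltW.
  rewrite mulrC powRrM powR_mulrn// ge0_ler_powR ?nnegrE ?(ltW a0)//.
  by rewrite -ler_pdivrMr// exp_term_le.
rewrite mulrA; apply: (le_trans (ler_wpM2l _ B1)).
  by rewrite !mulr_ge0 ?exprn_ge0 ?invr_ge0 ?(ltW C0) ?expR_ge0.
rewrite le_eqVlt; apply/orP; left; apply/eqP.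
have -> : k`!%:R `^ (- (1 - alpha)) = k`!%:R `^ alpha / k`!%:R.
  by rewrite opprB powRB ?(gt_eqF f0) ?implybT// powRr1// (ltW f0).
rewrite powRM ?expR_ge0 ?(ltW f0)// -expRM.
rewrite exprMn -expRM_natr.
have -> : expR (k.+1%:R * alpha) = expR alpha * expR (alpha * k%:R).
  by rewrite -expRD; congr expR; rewrite -natr1; ring.
rewrite mulrDl expRD; ring.
Qed.
End Coefficients.

(** * The limit for a fixed exponent *)

Section FixedExponent.
Variable R : realType.

Lemma ratio_le (a : nat -> R) (c : R) (M : nat) : 0 <= c ->
  (forall m, (M <= m)%N -> `|a m.+1| <= c * `|a m|) ->
  forall i, `|a (M + i)%N| <= `|a M| * c ^+ i.
Proof.
move=> c0 H; elim=> [|i ih]; first by rewrite addn0 expr0 mulr1.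
rewrite addnS; apply: le_trans (H _ (leq_addr _ _)) _.
by rewrite exprSr mulrA [leRHS]mulrC ler_wpM2l.
Qed.

Lemma cvg_geometric_decay (a : nat -> R) (c : R) (M : nat) : 0 <= c < 1 ->
  (forall m, (M <= m)%N -> `|a m.+1| <= c * `|a m|) -> a n @[n --> \oo] --> (0 : R).
Proof.
move=> /andP[c0 c1] H; rewrite -(cvg_shiftn M).
apply: norm_cvg0; apply: (@squeeze_cvgr _ _ _ _ (fun=> 0) (geometric `|a M| c)).
- by near=> n; rewrite normr_ge0/= addnC; exact: ratio_le.
- exact: cvg_cst.
- by apply: cvg_geometric; rewrite ger0_norm.
Unshelve. all: by end_near. Qed.

(** The rising factorial is a polynomial in N, beaten by the geometric factor. *)
Lemma cvg_expr_rising (p z : R) k : 0 <= p < 1 ->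
  p ^+ N * rising (z + N%:R) k @[N --> \oo] --> (0 : R).
Proof.
move=> /andP[p0 p1]; elim: k z => [|k ih] z.
  rewrite -(mulr0 1); under eq_cvg do rewrite rising0 mulrC.
  by apply: cvgMr; apply: cvg_expr; rewrite ger0_norm.
(* The ratio of consecutive terms tends to p, hence is eventually at most the
   larger constant c, still below 1. *)
pose c := (1 + p) / 2.
have c01 : 0 <= c < 1 by apply/andP; split; rewrite /c; lra.
pose M := (Num.truncn (`|z| + 2 * k.+1%:R / (1 - p))).+1.
apply: (@cvg_geometric_decay _ c M c01) => m Mm.
have zm : `|z| + 2 * k.+1%:R / (1 - p) <= m%:R.
  by apply: le_trans (ltW (truncnS_gt _)) _; rewrite ler_nat.
have q0 : 0 < 1 - p by rewrite subr_gt0.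
have kp : 0 <= 2 * k.+1%:R / (1 - p) by rewrite divr_ge0 ?(ltW q0)// mulr_ge0.
have zm0 : 2 * k.+1%:R / (1 - p) <= z + m%:R.
  by have := ler_norm (- z); rewrite normrN; lra.
have zm1 : 0 < z + m%:R by apply: lt_le_trans zm0; rewrite divr_gt0 ?mulr_gt0.
have r0 i : 0 <= rising (z + m%:R + 1) i.
  by rewrite /rising prodr_ge0// => j _; rewrite addr_ge0// addr_ge0// ltW.
rewrite -natr1 addrA (risingSr (z + m%:R + 1)) (risingSl (z + m%:R)) exprSr.
have R0 := r0 k; move: (rising _ _) R0 => r R0.
have p0' := exprn_ge0 m p0; move: (p ^+ m) p0' => P P0.
have zk : 0 <= z + m%:R + 1 + k%:R by rewrite addr_ge0// addr_ge0// ltW.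
rewrite !ger0_norm ?mulr_ge0 ?(ltW zm1)//.
have -> : P * p * (r * (z + m%:R + 1 + k%:R)) = (P * r) * (p * (z + m%:R + 1 + k%:R)) by ring.
have -> : c * (P * ((z + m%:R) * r)) = (P * r) * (c * (z + m%:R)) by ring.
rewrite ler_wpM2l ?mulr_ge0//.
move: zm0; rewrite ler_pdivrMr// -(natr1 k) /c.
have k0 : 0 <= k%:R :> R by [].
move: (z + m%:R) zm1 (k%:R : R) k0 => x x0 b b0 H.
have : p * (b + 1) <= b + 1 by rewrite ler_piMl ?(ltW p1)// addr_ge0.
lra.
Qed.

(** For K = 0 this is the negative binomial series of (1 - p)^-(n+1). The
    identity [E] in the induction is Pascal's rule summed over m:
    (1 - p) S (n + 1) equals S n plus the coefficient [bcoef K (n + 1)], up to a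
    boundary term that [cvg_expr_rising] kills. *)
Lemma cvg_negative_binomial (K p : R) n : 0 <= p < 1 ->
  series (fun m => p ^+ m * (rising (1 - K + m%:R) n / n`!%:R)) @ \oo -->
  (1 - p) ^- n.+1 * bsum K (1 - p) n.
Proof.
move=> p01; have [p0 p1] := andP p01.
have q0 : 1 - p != 0 by rewrite subr_eq0 gt_eqF.
elim: n => [|n ih].
  rewrite /bsum big_ord1 bcoef0 !mulr1 expr1.
  have := @cvg_geometric_series R 1 p; rewrite ger0_norm// => /(_ p1).
  rewrite div1r; under [X in series X @ _ --> _ -> _]eq_fun do rewrite mul1r.
  by under [X in _ -> series X @ _ --> _]eq_fun do rewrite rising0 divr1 mulr1.
pose S k := series (fun m => p ^+ m * (rising (1 - K + m%:R) k / k`!%:R)).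
have E N : S n.+1 N = (1 - p)^-1 *
    (bcoef K n.+1 + S n N - p ^+ N * rising (- K + N%:R) n.+1 / (n.+1)`!%:R).
  apply: (@mulfI _ (1 - p)) => //; rewrite mulVKf//.
  elim: N => [|N ihN].
    by rewrite /S /series/= !big_geq// mulr0 !addr0 mul1r addrN.
  rewrite /S !seriesSr -!/(S _) mulrDr ihN.
  have e1 : rising (1 - K + N%:R) n.+1 / (n.+1)`!%:R =
     rising (- K + N%:R) n.+1 / (n.+1)`!%:R + rising (1 - K + N%:R) n / n`!%:R.
    have -> : 1 - K + N%:R = - K + N%:R + 1 by ring.
    rewrite risingSr risingSl factS natrM -natr1.
    have f0 : n`!%:R != 0 :> R by rewrite pnatr_eq0 -lt0n fact_gt0.
    have n0 : n%:R + 1 != 0 :> R by rewrite natr1.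
    move: (n%:R : R) n0 (n`!%:R : R) f0 => a a0 b b0.
    by field; rewrite a0 b0.
  have -> : - K + N.+1%:R = 1 - K + N%:R by rewrite -natr1; ring.
  rewrite exprS; move: e1.
  have -> : p * p ^+ N * rising (1 - K + N%:R) n.+1 / (n.+1)`!%:R =
    p * p ^+ N * (rising (1 - K + N%:R) n.+1 / (n.+1)`!%:R) by ring.
  have -> : p ^+ N * rising (- K + N%:R) n.+1 / (n.+1)`!%:R =
    p ^+ N * (rising (- K + N%:R) n.+1 / (n.+1)`!%:R) by ring.
  move: (rising (1 - K + N%:R) n.+1 / _) (rising (- K + N%:R) n.+1 / _) (rising _ n / _).
  move=> x y w ->; ring.
rewrite -/(S n.+1) (funext E).
have -> : (1 - p) ^- n.+2 * bsum K (1 - p) n.+1 = (1 - p)^-1 *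
   (bcoef K n.+1 + (1 - p) ^- n.+1 * bsum K (1 - p) n - 0).
  rewrite bsumS subr0 exprS.
  have : (1 - p) ^+ n.+1 != 0 by rewrite expf_neq0.
  by move: ((1 - p) ^+ n.+1) => Q Q0; field; rewrite q0 Q0.
apply: cvgMr; apply: cvgB; first by apply: cvgD => //; exact: cvg_cst.
rewrite -(mul0r ((n.+1)`!%:R)^-1); apply: cvgMl.
exact: cvg_expr_rising.
Qed.

(** The series sum_m y^m / Gamma (1 - K + m). Both parts of the inner series of
    the theorem are of this form, for K = alpha (k + 1) and K = alpha k. *)
Definition inner_sum (y K : R) : R :=
  limn (series (fun m => y ^+ m * recip_Gamma (1 - K + m%:R))).

(** Tannery's theorem. The quotient of consecutive terms is
    y (1 / z + 1 / n) with z = 1 - K + m, so it is at most 1/2 as soon as z and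
    n exceed 4 y, and beyond the index M0 the terms decay geometrically; the
    finitely many terms before M0 are eventually within 1 of their limits. *)
Lemma cvg_inner_sum (y K : R) : 0 <= y ->
  cvgn (series (fun m => y ^+ m * recip_Gamma (1 - K + m%:R))) /\
  limn (series (fun m => y ^+ m * gauss (1 - K + m%:R) n.+1)) @[n --> \oo]
    --> inner_sum y K.
Proof.
move=> y0; rewrite /inner_sum; set g := fun m => _ * recip_Gamma _.
pose f n m := y ^+ m * gauss (1 - K + m%:R) n.+1.
have fg m : f n m @[n --> \oo] --> g m.
  apply: cvgMr; rewrite (cvg_shiftS (gauss (1 - K + m%:R))); exact: cvg_gauss.
pose M0 := (Num.truncn (`|K| + 4 * y)).+1.
pose C := \sum_(m < M0.+1) (`|g m| + 1) * 2 ^+ m.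
have Cm m : (m <= M0)%N -> `|g m| + 1 <= C * 2^-1 ^+ m.
  move=> mM; rewrite exprVn ler_pdivlMr ?exprn_gt0//.
  rewrite /C (bigD1 (inord m))//= inordK ?ltnS// lerDl sumr_ge0//.
apply: (@tannery R f g (geometric C 2^-1)) => //; last first.
  exact: cvg_geometric_half.
have fb m : \forall n \near \oo, `|f n m| <= `|g m| + 1.
  have /cvgrPdist_le/(_ 1 ltr01) := fg m.
  apply: filterS => n H.
  rewrite -lerBlDl; apply: le_trans H; rewrite distrC.
  exact: lerB_dist.
have fb' : \forall n \near \oo, forall m : 'I_M0.+1, `|f n m| <= `|g m| + 1.
  by apply: filter_forall => m; exact: fb.
near=> n => k.
have fn : forall m, (m <= M0)%N -> `|f n m| <= C * 2^-1 ^+ m.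
  move=> m mM; apply: le_trans (Cm m mM).
  have H : forall m : 'I_M0.+1, `|f n m| <= `|g m| + 1 by near: n.
  by have := H (Ordinal (mM : (m < M0.+1)%N)).
have [kM|Mk] := leqP k M0; first exact: fn.
rewrite -(subnKC (ltnW Mk)) /geometric/= exprD mulrA.
apply: le_trans (_ : `|f n M0| * 2^-1 ^+ (k - M0) <= _); last first.
  by rewrite ler_wpM2r ?exprn_ge0 ?invr_ge0// fn.
apply: ratio_le => // m Mm.
have n4 : 4 * y <= n.+1%:R.
  apply: (@le_trans _ _ n%:R); last by rewrite ler_nat.
  by near: n; exact: nbhs_infty_ger.
have zm : `|K| + 4 * y <= m%:R.
  by apply: le_trans (ltW (truncnS_gt _)) _; rewrite ler_nat.
have z4 : 4 * y + 1 <= 1 - K + m%:R by have := ler_norm K; lra.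
rewrite /f -(natr1 m) addrA.
move: (1 - K + m%:R) z4 => z z4.
have z0 : 0 < z by lra.
have n0 : 0 < n.+1%:R :> R by [].
have E : gauss (z + 1) n.+1 = (z + n.+1%:R) / (z * n.+1%:R) * gauss z n.+1.
  apply: (@mulfI _ (z * n.+1%:R)); first by rewrite mulf_neq0 ?gt_eqF.
  rewrite -gauss_rec [RHS]mulrA [X in _ = X * _]mulrC divfK//.
  by rewrite mulf_neq0 ?gt_eqF.
rewrite E; move: (gauss z n.+1) => G.
rewrite exprS; move: (y ^+ m) => Y.
rewrite (_ : y * Y * _ = Y * G * (y * ((z + n.+1%:R) / (z * n.+1%:R)))); last by ring.
rewrite normrM [leRHS]mulrC ler_wpM2l//.
have zn0 : 0 < z * n.+1%:R by rewrite mulr_gt0.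
rewrite ger0_norm; last by rewrite mulr_ge0// divr_ge0 ?(ltW zn0)// addr_ge0// ltW.
rewrite mulrA ler_pdivrMr//.
move: (n.+1%:R : R) n4 n0 => a a4 a0.
have H1 : 4 * y * a <= z * a by rewrite ler_wpM2r ?(ltW a0)//; lra.
have H2 : 4 * y * z <= a * z by rewrite ler_wpM2r ?(ltW z0).
lra.
Unshelve. all: by end_near. Qed.

(** The factor n^(1 - z) in Gauss's product at z = 1 - K + m is n^K / n^m: it
    turns y^m into (y / n)^m, and the series into the negative binomial
    expansion. *)
Lemma gauss_series (y K : R) n : y < n.+1%:R -> 0 <= y ->
  limn (series (fun m => y ^+ m * gauss (1 - K + m%:R) n.+1)) =
  n.+1%:R `^ K * ((1 - y / n.+1%:R) ^- n.+2 * bsum K (1 - y / n.+1%:R) n.+1).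
Proof.
move=> yn y0; apply/cvg_lim => //.
have n0 : 0 < n.+1%:R :> R by [].
have p01 : 0 <= y / n.+1%:R < 1 by rewrite divr_ge0//= ltr_pdivrMr// mul1r.
have H := @cvg_negative_binomial K _ n.+1 p01.
have {H} : n.+1%:R `^ K * series (fun m => (y / n.+1%:R) ^+ m *
    (rising (1 - K + m%:R) n.+1 / (n.+1)`!%:R)) N @[N --> \oo] -->
    n.+1%:R `^ K * ((1 - y / n.+1%:R) ^- n.+2 * bsum K (1 - y / n.+1%:R) n.+1).
  exact: cvgMr.
apply: cvg_trans; apply: near_eq_cvg; near=> N.
rewrite /series/= mulr_sumr; apply: eq_bigr => m _.
rewrite /gauss expr_div_n.
have -> : n.+1%:R `^ (1 - (1 - K + m%:R)) = n.+1%:R `^ K / n.+1%:R ^+ m :> R.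
  rewrite -powR_mulrn// -powRB ?(gt_eqF n0) ?implybT//; congr (_ `^ _); ring.
ring.
Unshelve. all: by end_near. Qed.

Lemma inner_sum0 (y : R) : 0 <= y -> inner_sum y 0 = expR y.
Proof.
move=> y0; rewrite /inner_sum /expR; congr (limn (series _)); apply/funext => m.
rewrite /exp_coeff subr0 addrC natr1.
by rewrite /recip_Gamma leNgt ltr0n andbF /Gamma ltr0n euler_gamma_nat.
Qed.

Lemma bsum_K0 (q : R) n : bsum 0 q n = 1.
Proof.
elim: n => [|n ih]; first by rewrite /bsum big_ord1 bcoef0 mul1r.
by rewrite bsumS ih /bcoef risingSl oppr0 !mul0r addr0.
Qed.

(** The Gauss series is n^K times bsum times a power of (1 - y / n)^-1. Dividing
    by the same identity for K = 0, where bsum is 1 and the limit is exp y,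
    removes that power. *)
Lemma cvg_bsum (y K : R) : 0 <= y ->
  n.+1%:R `^ K * bsum K (1 - y / n.+1%:R) n.+1 @[n --> \oo] -->
  expR (- y) * inner_sum y K.
Proof.
move=> y0.
have [_ H] := cvg_inner_sum K y0.
have [_] := cvg_inner_sum 0 y0; rewrite inner_sum0// => H0.
have : limn (series (fun m => y ^+ m * gauss (1 - K + m%:R) n.+1))
   * (limn (series (fun m => y ^+ m * gauss (1 - 0 + m%:R) n.+1)))^-1
   @[n --> \oo] --> inner_sum y K * (expR y)^-1.
  by apply: cvgM => //; apply: cvgV => //; rewrite gt_eqF// expR_gt0.
rewrite -expRN mulrC; apply: cvg_trans; apply: near_eq_cvg; near=> n.
have yn : y < n.+1%:R.
  by apply: (@lt_le_trans _ _ n%:R); [near: n; exact: nbhs_infty_gtr|rewrite ler_nat].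
rewrite !gauss_series// bsum_K0 powRr0 mul1r mulr1.
have : (1 - y / n.+1%:R) ^- n.+2 != 0.
  rewrite invr_eq0 expf_neq0// subr_eq0 gt_eqF// ltr_pdivrMr// mul1r//.
move: (_ ^- n.+2) (bsum _ _ _) => a b a0.
by rewrite mulrCA mulrAC mulfV// mul1r.
Unshelve. all: by end_near. Qed.

End FixedExponent.

(** * Power series with infinite radius of convergence *)

Section Entire.
Variable R : realType.

(** Infinite radius of convergence, in the form of geometric decay of c k C^k
    for every C. This form is stable under differentiation and under at most
    geometric factors, and hands explicit majorants to Tannery's theorem. *)
Definition entire (c : nat -> R) :=
  forall C : R, 0 < C -> exists M, forall k, `|c k| * C ^+ k <= M * 2^-1 ^+ k.

Lemma entire_cvg c (w : R) : entire c -> cvgn (pseries c w).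
Proof.
move=> ec; have [M HM] := ec (`|w| + 1) (ltr_pwDr ltr01 (normr_ge0 w)).
apply: (@cvg_series_dom _ _ (geometric M 2^-1)) => [k|].
  rewrite normrM normrX; apply: le_trans (HM k); rewrite ler_wpM2l//.
  by rewrite lerXn2r ?nnegrE ?addr_ge0// lerDl.
exact: cvg_geometric_half.
Qed.

Lemma entire_diffs c : entire c -> entire (pseries_diffs c).
Proof.
move=> ec C C0; have [M HM] := ec (2 * C) (mulr_gt0 (ltr0Sn _ 1) C0).
exists (M / (2 * C)) => k; have := HM k.+1.
rewrite /pseries_diffs normrM ger0_norm// => H.
have -> : M / (2 * C) * 2^-1 ^+ k = (M * 2^-1 ^+ k.+1) / C.
  by rewrite exprS; field; rewrite gt_eqF.
rewrite ler_pdivlMr//; apply: le_trans H.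
rewrite exprMn mulrCA.
have -> : k.+1%:R * `|c k.+1| * C ^+ k * C = k.+1%:R * (`|c k.+1| * C ^+ k.+1).
  by rewrite exprSr !mulrA.
rewrite ler_wpM2r ?mulr_ge0 ?exprn_ge0 ?(ltW C0)//.
by rewrite -natrX ler_nat ltnW// ltn_expl.
Qed.

Lemma entire_derive c (w : R) : entire c ->
  is_derive w (1 : R) (fun v => limn (pseries c v)) (limn (pseries (pseries_diffs c) w)).
Proof.
move=> ec.
apply: (@pseries_snd_diffs R c (`|w| + 1)); do ?exact: entire_cvg.
- by apply: entire_cvg; exact: entire_diffs.
- by apply: entire_cvg; do 2 apply: entire_diffs.
- by rewrite [ltRHS]ger0_norm ?addr_ge0// ltrDl.
Qed.

Lemma pseries_diffs_mul c (w : R) : entire c ->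
  w * limn (pseries (pseries_diffs c) w) = limn (pseries (fun k => k%:R * c k) w).
Proof.
move=> ec; apply/esym/cvg_lim => //.
rewrite -(cvg_shiftS (pseries _ w)).
have H : pseries (pseries_diffs c) w @ \oo --> limn (pseries (pseries_diffs c) w).
  by apply: entire_cvg; exact: entire_diffs.
have : w * pseries (pseries_diffs c) w n @[n --> \oo] -->
   w * limn (pseries (pseries_diffs c) w) by exact: cvgMr.
apply: cvg_trans; apply: near_eq_cvg; near=> n.
rewrite /pseries /series/= mulr_sumr big_nat_recl//= !mul0r add0r.
by apply: eq_bigr => i _; rewrite /pseries_diffs exprS; ring.
Unshelve. all: by end_near. Qed.

Lemma entire_le (c d : nat -> R) (A B : R) : 0 < A -> 0 < B ->
  (forall k, `|d k| <= A * B ^+ k * `|c k|) -> entire c -> entire d.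
Proof.
move=> A0 B0 dc ec C C0; have [M HM] := ec (B * C) (mulr_gt0 B0 C0).
exists (A * M) => k; rewrite -mulrA.
apply: le_trans (ler_wpM2l (ltW A0) (HM k)).
apply: le_trans (ler_wpM2r (exprn_ge0 k (ltW C0)) (dc k)) _.
by rewrite exprMn le_eqVlt; apply/orP; left; apply/eqP; ring.
Qed.

Lemma entire_exp (x : R) : entire (fun k => (- x) ^+ k / k`!%:R).
Proof.
move=> C C0; have [M HM] := @expr_fact_geometric R (`|x| * C) (mulr_ge0 (normr_ge0 _) (ltW C0)).
exists M => k; apply: le_trans (HM k).
rewrite normrM normrX normrN normfV [`|k`!%:R|]ger0_norm// exprMn.
by rewrite mulrAC.
Qed.

(** Each of the j factors is at most k + j in absolute value, and
    (k + j)^j / j! <= exp (k + j). For fixed j the growth in k is thus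
    geometric, as [entire_le] demands. *)
Lemma rising_le (z : R) (k j : nat) : 0 <= z <= k%:R ->
  `|rising (- z) j| <= j`!%:R * expR j%:R * expR 1 ^+ k.
Proof.
move=> /andP[z0 zk].
apply: (@le_trans _ _ ((k + j)%:R ^+ j)).
  rewrite /rising normr_prod -[X in _ ^+ X]card_ord -prodr_const.
  apply: ler_prod => i _; rewrite normr_ge0/= natrD.
  apply: le_trans (ler_normD _ _) _; rewrite normrN !ger0_norm//.
  by rewrite lerD// ler_nat ltnW.
have f0 : 0 < j`!%:R :> R by rewrite ltr0n fact_gt0.
have := @exp_term_le R (k + j)%:R j (ler0n _ _); rewrite ler_pdivrMr// => H.
apply: (le_trans H); rewrite natrD expRD -expRM_natl mulr1.
by rewrite le_eqVlt; apply/orP; left; apply/eqP; ring.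
Qed.

Lemma entire_rising (alpha x : R) j : 0 < alpha < 1 ->
  entire (fun k => (- x) ^+ k / k`!%:R * rising (- (alpha * k%:R)) j).
Proof.
move=> /andP[a0 a1].
apply: (@entire_le _ _ (j`!%:R * expR j%:R) (expR 1) _ _ _ (entire_exp x)).
- by rewrite mulr_gt0 ?expR_gt0// ltr0n fact_gt0.
- exact: expR_gt0.
- move=> k; rewrite normrM mulrC ler_wpM2r// rising_le//.
  by rewrite mulr_ge0 ?(ltW a0)//= ler_piMl// ltW.
Qed.

(** The function (- d/ds)^j exp (- x s^alpha), computed term by term from
    sum_k (- x)^k / k! s^(alpha k). *)
Definition stable_term (alpha x : R) (j : nat) (s : R) : R :=
  limn (pseries (fun k => (- x) ^+ k / k`!%:R * rising (- (alpha * k%:R)) j)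
    (s `^ alpha)) / s ^+ j.

(** Differentiate the power series at s^alpha by the chain rule and s^-j by the
    product rule; the factor alpha k + j so obtained extends the rising
    factorial of - alpha k by one step, up to the sign. *)
Lemma is_derive_stable_term (alpha x : R) j (s : R) : 0 < alpha < 1 -> 0 < s ->
  is_derive s (1 : R) (stable_term alpha x j) (- stable_term alpha x j.+1 s).
Proof.
move=> a01 s0; have [a0 a1] := andP a01.
set c := fun k => (- x) ^+ k / k`!%:R * rising (- (alpha * k%:R)) j.
have ec : entire c by exact: entire_rising.
have d1 := entire_derive (s `^ alpha) ec.
have d2 := is_derive1_powR alpha s0.
have d3 : is_derive s (1 : R) (fun v => limn (pseries c (v `^ alpha)))
  (limn (pseries (pseries_diffs c) (s `^ alpha)) * (alpha * s `^ (alpha - 1))).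
  exact: (@is_derive1_comp R (fun w => limn (pseries c w)) (fun v => v `^ alpha)).
have sj : s ^+ j != 0 by rewrite expf_neq0// gt_eqF.
have d4 : is_derive s (1 : R) (fun v => (v ^+ j)^-1) (- j%:R / s ^+ j.+1).
  have := is_deriveX j (@is_derive_id _ R s 1).
  rewrite exprfctE /GRing.scale/= mulr1 => dX.
  have := @is_deriveV R (fun v => v ^+ j) s _ 1 sj dX.
  move/is_derive_eq; apply; rewrite /GRing.scale/=.
  case: (j) sj => [|i] _; first by rewrite !mul0r mulr0 oppr0 mul0r.
  rewrite /= !exprS; have : s ^+ i != 0 by rewrite expf_neq0// gt_eqF.
  move: (s ^+ i) (i.+1%:R : R) => a b a0'.
  by field; rewrite a0' gt_eqF.
have -> : stable_term alpha x j = (fun v => limn (pseries c (v `^ alpha))) * (fun v => (v ^+ j)^-1).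
  by apply/funext.
apply: is_derive_eq.
rewrite /GRing.scale/=.
have -> : s `^ (alpha - 1) = s `^ alpha / s.
  by rewrite powRB ?(gt_eqF s0) ?implybT// powRr1// ltW.
have E := pseries_diffs_mul (s `^ alpha) ec.
have E2 : stable_term alpha x j.+1 s = (j%:R * limn (pseries c (s `^ alpha))
   - alpha * limn (pseries (fun k => k%:R * c k) (s `^ alpha))) / s ^+ j.+1.
  rewrite /stable_term; congr (_ / _).
  apply/cvg_lim => //.
  have ek : entire (fun k => k%:R * c k).
    apply: (@entire_le c _ 1 2 _ _ _ ec) => // k.
    rewrite normrM ger0_norm// mul1r ler_wpM2r// -natrX ler_nat ltnW//.
    exact: ltn_expl.
  have H1 := @entire_cvg c (s `^ alpha) ec.
  have H2 := @entire_cvg _ (s `^ alpha) ek.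
  have : j%:R * pseries c (s `^ alpha) n - alpha * pseries (fun k => k%:R * c k) (s `^ alpha) n
    @[n --> \oo] --> j%:R * limn (pseries c (s `^ alpha))
   - alpha * limn (pseries (fun k => k%:R * c k) (s `^ alpha)).
    by apply: cvgB; exact: cvgMr.
  apply: cvg_trans; apply: near_eq_cvg; near=> n.
  rewrite /pseries/series/= !mulr_sumr -sumrB; apply: eq_bigr => k _.
  by rewrite risingSr /c; ring.
rewrite E2 -E exprS.
move: (limn (pseries c _)) => a; move: (limn _) => b; move: (s `^ alpha) => w.
by field; rewrite sj gt_eqF.
Unshelve. all: by end_near. Qed.

End Entire.

(** * Moments from the Laplace transform *)

Section Moments.
Context d (T : measurableType d) (R : realType) (P : probability T R).
Variable f : T -> R.
Hypothesis mf : measurable_fun setT f.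
Hypothesis f0 : forall w, 0 <= f w.

Definition laplace_kernel (j : nat) (s : R) (w : T) : R := f w ^+ j * expR (- s * f w).

Definition laplace_moment (j : nat) (s : R) : R := \int[P]_w laplace_kernel j s w.

Lemma laplace_kernel_ge0 j s w : 0 <= laplace_kernel j s w.
Proof. by rewrite mulr_ge0 ?exprn_ge0 ?expR_ge0. Qed.

(** From (s v)^j / j! <= exp (s v). The constant bound makes the kernels
    integrable whatever the moments of f, and dominates their derivatives in s. *)
Lemma laplace_kernel_le j (s : R) w : 0 < s -> laplace_kernel j s w <= j`!%:R / s ^+ j.
Proof.
move=> s0; rewrite ler_pdivlMr ?exprn_gt0// mulrAC -exprMn.
have j0 : 0 < j`!%:R :> R by rewrite ltr0n fact_gt0.
rewrite mulNr expRN ler_pdivrMr ?expR_gt0// [leRHS]mulrC -ler_pdivrMr// mulrC.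
by rewrite mulrC [f w * s]mulrC exp_term_le// mulr_ge0// ltW.
Qed.

Lemma measurable_laplace_kernel j s : measurable_fun setT (laplace_kernel j s).
Proof.
apply: measurable_funM; first exact: measurable_funX.
by apply: measurableT_comp => //; exact: measurable_funM.
Qed.

Lemma integrable_bounded (g : T -> R) (C : R) : measurable_fun setT g ->
  (forall w, `|g w| <= C) -> P.-integrable setT (EFin \o g).
Proof.
move=> mg gC; apply: measurable_bounded_integrable => //.
  by rewrite (le_lt_trans (probability_le1 _ _))// ltry.
exists C; split; first by rewrite num_real.
by move=> x Cx w _ /=; rewrite (le_trans (gC w))// ltW.
Qed.

Lemma integrable_laplace_kernel j (s : R) : 0 < s ->
  P.-integrable setT (EFin \o laplace_kernel j s).
Proof.
move=> s0; apply: (@integrable_bounded _ (j`!%:R / s ^+ j)).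
  exact: measurable_laplace_kernel.
by move=> w; rewrite ger0_norm ?laplace_kernel_ge0// laplace_kernel_le.
Qed.

Lemma is_derive_laplace_kernel j (s : R) w :
  is_derive s (1 : R) (laplace_kernel j ^~ w) (- laplace_kernel j.+1 s w).
Proof.
rewrite /laplace_kernel; apply: is_derive_eq.
by rewrite /GRing.scale/= exprS; ring.
Qed.

(** Differentiation under the integral sign, with s confined to an interval
    bounded below by s / 2 where the kernel of order j + 1 has a constant
    bound. *)
Lemma is_derive_laplace_moment j (s : R) : 0 < s ->
  is_derive s (1 : R) (laplace_moment j) (- laplace_moment j.+1 s).
Proof.
move=> s0; pose u := s / 2; have u0 : 0 < u by rewrite divr_gt0.
have Is : [set` `]u, s + 1[] s by rewrite /= in_itv/= /u; apply/andP; split; lra.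
have Iu x : [set` `]u, s + 1[] x -> 0 < x.
  by rewrite /= in_itv/= => /andP[ux _]; exact: lt_trans ux.
have d1 x w : partial1of2 (laplace_kernel j) x w = - laplace_kernel j.+1 x w.
  by rewrite partial1of2E; have [_ ->] := is_derive_laplace_kernel j x w.
have H1 : forall x, [set` `]u, s + 1[] x -> P.-integrable setT (EFin \o laplace_kernel j x).
  by move=> x /Iu; exact: integrable_laplace_kernel.
have H2 : forall x w, [set` `]u, s + 1[] x -> setT w -> derivable (laplace_kernel j ^~ w) x 1.
  by move=> x w _ _; have [] := is_derive_laplace_kernel j x w.
have G0 : forall w : T, 0 <= cst ((j.+1)`!%:R / u ^+ j.+1) w :> R.
  by move=> w /=; rewrite divr_ge0 ?exprn_ge0 ?(ltW u0).
have iG : P.-integrable setT (EFin \o (cst ((j.+1)`!%:R / u ^+ j.+1) : T -> R)).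
  by apply: (@integrable_bounded _ `|(j.+1)`!%:R / u ^+ j.+1|).
have H3 : forall x w, [set` `]u, s + 1[] x -> setT w ->
    `|partial1of2 (laplace_kernel j) x w| <= cst ((j.+1)`!%:R / u ^+ j.+1) w.
  move=> x w xI _; rewrite d1 normrN ger0_norm ?laplace_kernel_ge0//=.
  have x0 := Iu _ xI.
  apply: le_trans (laplace_kernel_le _ _ x0) _.
  rewrite ler_wpM2l// lef_pV2 ?posrE ?exprn_gt0//.
  rewrite lerXn2r ?nnegrE ?(ltW u0) ?(ltW x0)//.
  by move: xI; rewrite /= in_itv/= => /andP[/ltW].
have mT : d.-measurable [set: T] by [].
have D := derivable_under_integral mT Is H1 H2 G0 iG H3.
have E := differentiation_under_integral mT Is H1 H2 G0 iG H3.
apply: DeriveDef => //.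
rewrite -derive1E E.
under eq_Rintegral do rewrite d1 -mulN1r.
by rewrite RintegralZl ?mulN1r//; exact: integrable_laplace_kernel.
Qed.

Variables (alpha lambda x : R).
Hypothesis alpha01 : 0 < alpha < 1.
Hypothesis lambda0 : 0 < lambda.
Hypothesis laplaceE : forall s, 0 < s -> laplace_moment 0 s =
  expR (- x * ((s + lambda) `^ alpha - lambda `^ alpha)).

(** Both sides satisfy the same recursion under - d/ds, and for j = 0 the claim
    is the exponential series of the Laplace transform. *)
Lemma laplace_momentE j (s : R) : 0 < s -> laplace_moment j s =
  expR (lambda `^ alpha * x) * stable_term alpha x j (s + lambda).
Proof.
elim: j s => [|j ih] s s0.
  rewrite laplaceE// /stable_term expr0 divr1.
  rewrite mulrBr [- x * lambda `^ alpha]mulNr opprK addrC expRD [x * _]mulrC; congr (_ * _).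
  rewrite {1}/expR /=; congr (limn (series _)); apply/funext => k.
  by rewrite /exp_coeff/= rising0 mulr1 exprMn mulrAC.
have s1 : 0 < s + lambda by rewrite addr_gt0.
have D1 := is_derive_laplace_moment j s0.
have D2 : is_derive s (1 : R)
   (fun v => expR (lambda `^ alpha * x) * stable_term alpha x j (v + lambda))
   (expR (lambda `^ alpha * x) * - stable_term alpha x j.+1 (s + lambda)).
  have D3 := is_derive_stable_term x j alpha01 s1.
  have D4 : is_derive s (1 : R) (fun v => stable_term alpha x j (v + lambda))
      (- stable_term alpha x j.+1 (s + lambda) * 1).
    apply: (@is_derive1_comp R (stable_term alpha x j) (fun v => v + lambda)).
    by apply: is_derive_eq; rewrite addr0.
  by apply: is_derive_eq; rewrite mulr1.
have : 'D_1 (laplace_moment j) s =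
    'D_1 (fun v => expR (lambda `^ alpha * x) * stable_term alpha x j (v + lambda)) s.
  apply: near_eq_derive => //; near=> v; apply: ih.
  by near: v; exact: lt_nbhsr.
have [_ ->] := D1; have [_ ->] := D2.
by rewrite mulrN => /oppr_inj.
Unshelve. all: by end_near. Qed.

Definition poisson_cdf (n : nat) (y : R) : R := \sum_(j < n.+1) y ^+ j / j`!%:R * expR (- y).

(** The sum over the Poisson weights of order j <= n and the series over k are
    exchanged; for fixed k the weights collect into the Taylor sum of (1 - q)^K
    at q = s / (s + lambda). *)
Lemma expectation_poisson_cdf n (s : R) : 0 < s ->
  \int[P]_w poisson_cdf n (s * f w) =
  expR (lambda `^ alpha * x) *
  limn (series (fun k => (- x) ^+ k / k`!%:R * ((s + lambda) `^ (alpha * k%:R)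
     * bsum (alpha * k%:R) (s / (s + lambda)) n))).
Proof.
move=> s0; have s1 : 0 < s + lambda by rewrite addr_gt0.
have E1 : \int[P]_w poisson_cdf n (s * f w) =
   \sum_(j < n.+1) s ^+ j / j`!%:R * laplace_moment j s.
  rewrite /poisson_cdf; elim: n.+1 => [|m ih].
    rewrite big_ord0; under eq_Rintegral do rewrite big_ord0.
    by rewrite Rintegral_cst// mul0r.
  have mk j : measurable_fun setT (fun w : T => (s * f w) ^+ j / j`!%:R * expR (- (s * f w))).
    rewrite (_ : (fun _ => _) = (fun w => s ^+ j / j`!%:R * laplace_kernel j s w)).
      by apply: measurable_funM => //; exact: measurable_laplace_kernel.
    by apply/funext => w; rewrite /laplace_kernel exprMn mulNr; ring.
  have ik j : P.-integrable setT (EFin \o (fun w : T => (s * f w) ^+ j / j`!%:R * expR (- (s * f w)))).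
    apply: (@integrable_bounded _ 1) => // w.
    rewrite ger0_norm; last first.
      by rewrite !mulr_ge0 ?expR_ge0// ?exprn_ge0 ?invr_ge0// mulr_ge0// ltW.
    by rewrite expRN ler_pdivrMr ?expR_gt0// mul1r exp_term_le// mulr_ge0// ltW.
  under eq_Rintegral do rewrite big_ord_recr/=.
  rewrite RintegralD//; last first.
    rewrite (_ : _ \o _ = (fun w => \sum_(i < m) ((s * f w) ^+ i / i`!%:R * expR (- (s * f w)))%:E)%E); last first.
      by apply/funext => w; rewrite /= sumEFin.
    by apply: integrable_sum => // i _; exact: ik.
  rewrite ih big_ord_recr/=; congr (_ + _).
  rewrite /laplace_moment -RintegralZl//; last exact: integrable_laplace_kernel.
  apply: eq_Rintegral => w _; rewrite /laplace_kernel exprMn mulNr; ring.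
rewrite E1.
under eq_bigr do rewrite laplace_momentE// mulrCA.
rewrite -mulr_sumr; congr (_ * _); apply/esym/cvg_lim => //.
pose c j k := (- x) ^+ k / k`!%:R * rising (- (alpha * k%:R)) j.
have H j : pseries (c j) ((s + lambda) `^ alpha) N @[N --> \oo] -->
   limn (pseries (c j) ((s + lambda) `^ alpha)).
  by apply: entire_cvg; exact: entire_rising.
have : \sum_(j < n.+1) (s ^+ j / j`!%:R) * (pseries (c j) ((s + lambda) `^ alpha) N / (s + lambda) ^+ j)
  @[N --> \oo] --> \sum_(j < n.+1) (s ^+ j / j`!%:R) * stable_term alpha x j (s + lambda).
  apply: (@cvg_sum_seq _ _ _ _ _ (fun (j : 'I_n.+1) N => (s ^+ j / j`!%:R) * (pseries (c j) ((s + lambda) `^ alpha) N / (s + lambda) ^+ j))) => j.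
  by apply: cvgMr; apply: cvgMl; exact: H.
apply: cvg_trans; apply: near_eq_cvg; near=> N.
rewrite /pseries /series/=.
under eq_bigr do rewrite mulr_suml mulr_sumr.
rewrite exchange_big/=; apply: eq_bigr => k _.
rewrite /bsum !mulr_sumr; apply: eq_bigr => j _.
rewrite powRrM powR_mulrn ?powR_ge0// /c /bcoef expr_div_n; ring.
Unshelve. all: by end_near. Qed.

End Moments.

(** * Concentration of the Poisson distribution *)

Section PoissonCdf.
Variable R : realType.

Lemma exp_partial_le (x : R) n : 0 <= x -> \sum_(j < n) x ^+ j / j`!%:R <= expR x.
Proof.
move=> x0; have nd : nondecreasing_seq (series (exp_coeff x)).
  by apply/nondecreasing_seqP => m; rewrite seriesSr lerDl exp_coeff_ge0.
have := nondecreasing_cvgn_le nd (is_cvg_series_exp_coeff x) n.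
by rewrite /series/= big_mkord.
Qed.

Lemma poisson_cdfE n (y : R) :
  poisson_cdf n y = (\sum_(j < n.+1) y ^+ j / j`!%:R) / expR y.
Proof. by rewrite /poisson_cdf -mulr_suml expRN. Qed.

Lemma poisson_cdf_ge0 n (y : R) : 0 <= y -> 0 <= poisson_cdf n y.
Proof.
move=> y0; rewrite /poisson_cdf sumr_ge0// => j _.
by rewrite !mulr_ge0 ?expR_ge0 ?exprn_ge0 ?invr_ge0.
Qed.

Lemma poisson_cdf_le1 n (y : R) : 0 <= y -> poisson_cdf n y <= 1.
Proof.
by move=> y0; rewrite poisson_cdfE ler_pdivrMr ?expR_gt0// mul1r exp_partial_le.
Qed.

Lemma continuous_poisson_cdf n : continuous (@poisson_cdf R n).
Proof.
move=> y; rewrite /poisson_cdf; apply: (@cvg_sum_seq R _ _ _ _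
  (fun (j : 'I_n.+1) v => v ^+ j / j`!%:R * expR (- v))
  (fun j => y ^+ j / j`!%:R * expR (- y))) => j.
apply: cvgM.
  by apply: cvgMl; exact: exprn_continuous.
apply: continuous_cvg; first exact: continuous_expR.
by apply: cvgN; exact: cvg_id.
Qed.

(** Chernoff: for j <= n and th <= 1, the j-th weight is at most th^(j - n)
    times itself, and the generating function of the Poisson distribution sums
    the result. *)
Lemma poisson_lower_tail n (y th : R) : 0 <= y -> 0 < th <= 1 ->
  poisson_cdf n y <= th ^- n * expR ((th - 1) * y).
Proof.
move=> y0 /andP[t0 t1].
rewrite poisson_cdfE mulrBl mul1r expRB mulrA ler_wpM2r ?invr_ge0 ?expR_ge0//.
rewrite ler_pdivlMl ?exprn_gt0// mulr_sumr.
apply: le_trans (_ : \sum_(j < n.+1) (th * y) ^+ j / j`!%:R <= _).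
  apply: ler_sum => j _; rewrite exprMn -mulrA ler_wpM2r//.
    by rewrite divr_ge0 ?exprn_ge0.
  by rewrite ler_wiXn2l ?(ltW t0)// -ltnS.
by rewrite exp_partial_le// mulr_ge0// ltW.
Qed.

Lemma poisson_upper_tail n (y th : R) : 0 <= y -> 1 <= th ->
  1 - poisson_cdf n y <= th ^- n.+1 * expR ((th - 1) * y).
Proof.
move=> y0 t1; have t0 : 0 < th by rewrite (lt_le_trans _ t1).
rewrite poisson_cdfE mulrBl mul1r expRB mulrA.
rewrite -[X in X - _](@divff _ (expR y)) ?gt_eqF ?expR_gt0// -mulrBl.
rewrite ler_wpM2r ?invr_ge0 ?expR_ge0// lerBlDr.
have H : series (exp_coeff y) @ \oo --> expR y by exact: is_cvg_series_exp_coeff.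
rewrite -(cvg_lim _ H)//; apply: limr_le; first by apply/cvg_ex; eexists; exact: H.
near=> N.
have nN : (n.+1 <= N)%N by near: N; exact: nbhs_infty_ge.
rewrite /series/= (@big_cat_nat _ _ _ n.+1)//= big_mkord addrC lerD2r.
rewrite ler_pdivlMl ?exprn_gt0// mulr_sumr.
apply: (@le_trans _ _ (series (exp_coeff (th * y)) N)).
  rewrite /series/= [leRHS](@big_cat_nat _ _ _ n.+1)//=.
  rewrite -[leLHS]add0r; apply: lerD.
    by rewrite sumr_ge0// => i _; rewrite exp_coeff_ge0// mulr_ge0// ltW.
  rewrite big_seq [leRHS]big_seq; apply: ler_sum => i; rewrite mem_index_iota.
  move=> /andP[ni _]; rewrite /exp_coeff/= exprMn -mulrA ler_wpM2r//.
    by rewrite divr_ge0 ?exprn_ge0.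
  by rewrite ler_weXn2l.
by rewrite /series/= big_mkord exp_partial_le// mulr_ge0// ltW.
Unshelve. all: by end_near. Qed.

(** The optimal th in the Chernoff bounds is 1 / de. The choice 2 / (1 + de)
    also works at de = 0, and needs only exp v >= 1 + v: the gap
    1 - (th - 1) de - 1 / th is the square (1 - de)^2 over 2 (1 + de). *)
Lemma chernoff_base (de : R) : 0 <= de -> de != 1 ->
  0 <= expR ((2 / (1 + de) - 1) * de) / (2 / (1 + de)) < 1.
Proof.
set th := 2 / _; move=> d0 d1; have d2 : 0 < 1 + de by lra.
have th0 : 0 < th by rewrite divr_gt0.
rewrite divr_ge0 ?expR_ge0 ?(ltW th0)//= ltr_pdivrMr// mul1r.
rewrite -[ltRHS]invrK -[ltLHS]invrK ltf_pV2 ?posrE ?invr_gt0 ?expR_gt0//.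
rewrite -expRN; apply: lt_le_trans (expR_ge1Dx _).
rewrite -subr_gt0.
have -> : 1 + - ((th - 1) * de) - th^-1 = (1 - de) ^+ 2 / (2 * (1 + de)).
  by rewrite /th; field; rewrite gt_eqF.
apply: divr_gt0; last by rewrite mulr_gt0.
by rewrite exprn_even_gt0//= subr_eq0 eq_sym.
Qed.

Lemma expR_div_X (a b : R) n : (expR a / b) ^+ n = expR (n%:R * a) / b ^+ n.
Proof. by rewrite expr_div_n -expRM_natl. Qed.

(** The mean is about n v / t, with v / t < 1. Lowering it by lambda v only
    helps here, while above t (see [cvg_poisson_gt]) it costs a constant
    factor. *)
Lemma cvg_poisson_lt (lambda t v : R) : 0 < t -> 0 <= lambda -> 0 <= v < t ->
  poisson_cdf n.+1 ((n.+1%:R / t - lambda) * v) @[n --> \oo] --> (1 : R).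
Proof.
move=> t0 l0 /andP[v0 vt].
pose de := v / t.
have de0 : 0 <= de by rewrite divr_ge0// ltW.
have de1 : de < 1 by rewrite ltr_pdivrMr// mul1r.
have := chernoff_base de0 (negbT (lt_eqF de1)).
set th := 2 / (1 + de) => /= /andP[b0 b1].
have th1 : 1 < th by rewrite ltr_pdivlMr; lra.
have th0 : 0 < th by lra.
have H : (expR ((th - 1) * de) / th) ^+ n.+1 @[n --> \oo] --> (0 : R).
  rewrite (cvg_shiftS (fun n => (expR ((th - 1) * de) / th) ^+ n)).
  by apply: cvg_expr; rewrite ger0_norm.
have H1 : 1 - (expR ((th - 1) * de) / th) ^+ n.+1 @[n --> \oo] --> (1 : R).
  by rewrite -[X in _ --> X](subr0 1); apply: cvgB => //; exact: cvg_cst.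
apply: (@squeeze_cvgr _ _ _ _ (fun n => 1 - (expR ((th - 1) * de) / th) ^+ n.+1) (fun=> 1)) => //; last exact: cvg_cst.
near=> n.
have r0 : 0 <= n.+1%:R / t - lambda.
  rewrite subr_ge0 ler_pdivlMr// (@le_trans _ _ n%:R) ?ler_nat//.
  by near: n; exact: nbhs_infty_ger.
have y0 : 0 <= (n.+1%:R / t - lambda) * v by rewrite mulr_ge0.
rewrite poisson_cdf_le1// andbT lerBlDr -lerBlDl.
apply: le_trans (poisson_upper_tail _ y0 (ltW th1)) _.
rewrite expR_div_X mulrC ler_pM ?expR_ge0 ?invr_ge0 ?exprn_ge0 ?(ltW th0)//.
  rewrite ler_expR [leRHS]mulrCA ler_wpM2l//; first by lra.
  have -> : n.+1%:R * de = n.+1%:R / t * v by rewrite /de; ring.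
  by rewrite ler_wpM2r// gerBl.
rewrite lef_pV2 ?posrE ?exprn_gt0// ler_weXn2l//; lra.
Unshelve. all: by end_near. Qed.

Lemma cvg_poisson_gt (lambda t v : R) : 0 < t -> 0 <= lambda -> t < v ->
  poisson_cdf n.+1 ((n.+1%:R / t - lambda) * v) @[n --> \oo] --> (0 : R).
Proof.
move=> t0 l0 vt.
have v0 : 0 < v by exact: lt_trans vt.
pose de := v / t.
have de1 : 1 < de by rewrite ltr_pdivlMr// mul1r.
have de0 : 0 <= de by lra.
have := chernoff_base de0 (negbT (gt_eqF de1)).
set th := 2 / (1 + de) => /= /andP[b0 b1].
have th0 : 0 < th by rewrite divr_gt0//; lra.
have th1 : th <= 1 by rewrite ler_pdivrMr; lra.
have H : (expR ((th - 1) * de) / th) ^+ n.+1 @[n --> \oo] --> (0 : R).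
  rewrite (cvg_shiftS (fun n => (expR ((th - 1) * de) / th) ^+ n)).
  by apply: cvg_expr; rewrite ger0_norm.
have H1 : (expR ((th - 1) * de) / th) ^+ n.+1 * expR ((1 - th) * (lambda * v)) @[n --> \oo] --> (0 : R).
  by rewrite -[X in _ --> X](mul0r (expR ((1 - th) * (lambda * v)))); apply: cvgMl.
apply: (@squeeze_cvgr _ _ _ _ (fun=> 0) (fun n => (expR ((th - 1) * de) / th) ^+ n.+1 * expR ((1 - th) * (lambda * v)))) => //; last exact: cvg_cst.
near=> n.
have r0 : 0 <= n.+1%:R / t - lambda.
  rewrite subr_ge0 ler_pdivlMr// (@le_trans _ _ n%:R) ?ler_nat//.
  by near: n; exact: nbhs_infty_ger.
have y0 : 0 <= (n.+1%:R / t - lambda) * v by rewrite mulr_ge0// ltW.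
rewrite poisson_cdf_ge0//=.
have th01 : 0 < th <= 1 by rewrite th0.
apply: le_trans (poisson_lower_tail _ y0 th01) _.
rewrite expR_div_X mulrAC -expRD mulrC ler_wpM2r ?invr_ge0 ?exprn_ge0 ?(ltW th0)//.
rewrite ler_expR /de le_eqVlt; apply/orP; left; apply/eqP; ring.
Unshelve. all: by end_near. Qed.

End PoissonCdf.

(** * Laplace inversion *)

Section SurvivalSeries.
Variable R : realType.

Lemma bsum_coef_bound (alpha y : R) n k : 0 < alpha -> 0 < y <= n.+1%:R ->
  n.+1%:R `^ (alpha * k%:R) * `|bsum (alpha * k%:R) (1 - y / n.+1%:R) n.+1|
  <= coef_bound alpha y k.
Proof.
move=> a0 /andP[y0 yn]; rewrite /coef_bound.
have K0 : 0 <= alpha * k%:R by rewrite mulr_ge0// ltW.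
move: (alpha * k%:R) K0 => K K0.
have n0 : 0 < n.+1%:R :> R by [].
have p0 : 0 < y / n.+1%:R by rewrite divr_gt0.
have p1 : y / n.+1%:R <= 1 by rewrite ler_pdivrMr// mul1r.
have q01 : 0 <= 1 - y / n.+1%:R < 1 by rewrite subr_ge0 p1 gtrBl p0.
have := bsum_le n.+1 K0 q01; rewrite subKr => H.
apply: le_trans (ler_wpM2l (powR_ge0 _ _) H) _; rewrite mulrDr; apply: lerD.
  by rewrite -powRM ?(ltW p0)// mulrC divfK// gt_eqF.
apply: le_trans (bres_le n.+1 K0); rewrite ler_wpM2r//.
by rewrite ge0_ler_powR ?nnegrE// ler_nat.
Qed.

Lemma inner_sum_bound (alpha y : R) k : 0 < alpha -> 0 < y ->
  `|expR (- y) * inner_sum y (alpha * k%:R)| <= coef_bound alpha y k.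
Proof.
move=> a0 y0.
have H := cvg_norm (@cvg_bsum R y (alpha * k%:R) (ltW y0)).
rewrite -(cvg_lim _ (H _))//; apply: limr_le; first by apply/cvg_ex; eexists; exact: H.
near=> n; rewrite normrM ger0_norm ?powR_ge0//.
apply: bsum_coef_bound => //; rewrite y0/= (@le_trans _ _ n%:R) ?ler_nat//.
by near: n; exact: nbhs_infty_ger.
Unshelve. all: by end_near. Qed.

(** The coefficient of x^k in the limit of the k-th term of
    [expectation_poisson_cdf] at s + lambda = n / t, with y = lambda t. *)
Definition surv_coef (alpha y t : R) (k : nat) : R :=
  (- 1) ^+ k / k`!%:R * (t `^ (- (alpha * k%:R)) * (expR (- y) * inner_sum y (alpha * k%:R))).

(** Brings the k-th term to the shape majorized by [coef_bound_geometric], both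
    for the limit and before it. *)
Lemma term_bound (alpha t C a : R) k : 0 <= t -> 0 <= C ->
  `|(- 1) ^+ k / k`!%:R * (t `^ (- (alpha * k%:R)) * a)| * C ^+ k =
  (t `^ (- alpha) * C) ^+ k / k`!%:R * `|a|.
Proof.
move=> t0 C0; rewrite !normrM normrX normrN normr1 expr1n mul1r.
rewrite normfV [`|k`!%:R|]ger0_norm// [`|t `^ _|]ger0_norm ?powR_ge0//.
rewrite -mulNr powRrM powR_mulrn ?powR_ge0// exprMn; ring.
Qed.

Lemma entire_surv_coef (alpha y t : R) : 0 < alpha < 1 -> 0 < y -> 0 < t ->
  entire (surv_coef alpha y t).
Proof.
move=> a01 y0 t0 C C0; have [a0 _] := andP a01.
have tC : 0 < t `^ (- alpha) * C by rewrite mulr_gt0 ?powR_gt0.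
have [M HM] := coef_bound_geometric a01 (ltW y0) tC.
exists M => k; rewrite term_bound ?(ltW t0) ?(ltW C0)//.
apply: le_trans (HM k); rewrite ler_wpM2l ?divr_ge0 ?exprn_ge0 ?(ltW tC)//.
exact: inner_sum_bound.
Qed.

Lemma cvg_surv_series (alpha y t x : R) : 0 < alpha < 1 -> 0 < y -> 0 < t ->
  limn (series (fun k => (- x) ^+ k / k`!%:R * ((n.+1%:R / t) `^ (alpha * k%:R)
     * bsum (alpha * k%:R) (1 - y / n.+1%:R) n.+1))) @[n --> \oo] -->
  limn (pseries (surv_coef alpha y t) x).
Proof.
move=> a01 y0 t0; have [a0 _] := andP a01.
pose C : R := `|x| + 1; have C0 : 0 < C by rewrite ltr_pwDr.
have tC : 0 < t `^ (- alpha) * C by rewrite mulr_gt0 ?powR_gt0.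
have [M HM] := coef_bound_geometric a01 (ltW y0) tC.
have E n k : (- x) ^+ k / k`!%:R * ((n.+1%:R / t) `^ (alpha * k%:R)
     * bsum (alpha * k%:R) (1 - y / n.+1%:R) n.+1) =
   (- 1) ^+ k / k`!%:R * (t `^ (- (alpha * k%:R)) * (n.+1%:R `^ (alpha * k%:R)
     * bsum (alpha * k%:R) (1 - y / n.+1%:R) n.+1)) * x ^+ k.
  rewrite powRM ?invr_ge0 ?(ltW t0)// -[t^-1]powR_inv1 ?(ltW t0)// -powRrM mulN1r.
  by rewrite [(- x) ^+ k]exprNn; ring.
pose F n k := (- x) ^+ k / k`!%:R * ((n.+1%:R / t) `^ (alpha * k%:R)
     * bsum (alpha * k%:R) (1 - y / n.+1%:R) n.+1).
suff [] : cvgn (series (fun k => surv_coef alpha y t k * x ^+ k)) /\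
  limn (series (F n)) @[n --> \oo] --> limn (series (fun k => surv_coef alpha y t k * x ^+ k)).
  by [].
apply: (@tannery R F (fun k => surv_coef alpha y t k * x ^+ k) (geometric M 2^-1)).
  near=> n => k; rewrite /F E normrM normrX.
  apply: le_trans (HM k).
  apply: le_trans (ler_wpM2l _ (lerXn2r k _ _ (_ : `|x| <= C))) _ => //.
  - by rewrite nnegrE ltW.
  - by rewrite lerDl.
  rewrite term_bound ?(ltW t0) ?(ltW C0)//.
  rewrite ler_wpM2l ?divr_ge0 ?exprn_ge0 ?(ltW tC)//.
  rewrite normrM ger0_norm ?powR_ge0//.
  apply: bsum_coef_bound => //; rewrite y0/= (@le_trans _ _ n%:R) ?ler_nat//.
  by near: n; exact: nbhs_infty_ger.
  exact: cvg_geometric_half.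
move=> k; rewrite /F; under eq_cvg do rewrite E.
apply: cvgMl; apply: cvgMr; apply: cvgMr.
exact: cvg_bsum (ltW y0).
Unshelve. all: by end_near. Qed.

Definition survival (alpha lambda t x : R) : R :=
  expR (lambda `^ alpha * x) * limn (pseries (surv_coef alpha (lambda * t) t) x).

End SurvivalSeries.

Section Sandwich.
Context d (T : measurableType d) (R : realType) (P : probability T R).
Variable f : T -> R.
Hypothesis mf : measurable_fun setT f.
Hypothesis f0 : forall w, 0 <= f w.
Variables (alpha lambda x : R).
Hypothesis alpha01 : 0 < alpha < 1.
Hypothesis lambda0 : 0 < lambda.
Hypothesis laplaceE : forall s, 0 < s -> laplace_moment P f 0 s =
  expR (- x * ((s + lambda) `^ alpha - lambda `^ alpha)).

Lemma bounded_cvg_Rintegral (g : nat -> T -> R) (h : T -> R) :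
  (forall n, measurable_fun setT (g n)) -> measurable_fun setT h ->
  (forall n w, `|g n w| <= 1) -> (forall w, g n w @[n --> \oo] --> h w) ->
  \int[P]_w g n w @[n --> \oo] --> \int[P]_w h w.
Proof.
move=> mg mh g1 gh.
have mg' n : measurable_fun setT (fun w => (g n w)%:E) by apply/measurable_EFinP.
have mh' : measurable_fun setT (fun w => (h w)%:E) by apply/measurable_EFinP.
have gh' : {ae P, forall w, setT w -> (g n w)%:E @[n --> \oo] --> (h w)%:E}.
  apply: aeW => w _; apply: cvg_EFin; first by near=> n.
  exact: gh.
have i1 : P.-integrable setT (EFin \o (cst 1 : T -> R)).
  by apply: (@integrable_bounded _ _ _ _ _ 1) => // w; rewrite normr1.
have g1' : {ae P, forall w n, setT w -> (`|(g n w)%:E| <= (EFin \o cst (1%R : R)) w)%E}.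
  by apply: aeW => w n _; rewrite lee_fin.
have [ih _ H] := dominated_convergence measurableT mg' mh' gh' i1 g1'.
apply: fine_cvg; rewrite fineK; first exact: H.
exact: integrable_fin_num ih.
Unshelve. all: by end_near. Qed.

(** The Poisson probabilities Q n (s f) converge to the indicator of f < t off
    the event f = t, where nothing is claimed. Multiplied by the indicators of
    f < t and t < f they converge everywhere, and bounded convergence gives one
    inequality from each. *)
Lemma survival_sandwich (t : R) : 0 < t ->
  fine (P [set w | f w < t]) <= survival alpha lambda t x <= fine (P [set w | f w <= t]).
Proof.
move=> t0; have y0 : 0 < lambda * t by rewrite mulr_gt0.
(* Dropping the first N indices makes s n positive for every n. *)
pose N := (Num.truncn (lambda * t)).+1.
pose s n : R := (n + N).+1%:R / t - lambda.
have s0 n : 0 < s n.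
  rewrite subr_gt0 ltr_pdivlMr// (lt_le_trans (truncnS_gt _))// ler_nat.
  by rewrite ltnW// ltnS leq_addl.
pose Q n w := poisson_cdf (n + N).+1 (s n * f w).
have Q01 n w : 0 <= Q n w <= 1.
  have y : 0 <= s n * f w by rewrite mulr_ge0// ltW.
  by rewrite poisson_cdf_ge0 ?poisson_cdf_le1.
have mQ n : measurable_fun setT (Q n).
  apply: (@measurableT_comp _ _ _ _ _ _ (@poisson_cdf R (n + N).+1)).
    by apply: continuous_measurable_fun; exact: continuous_poisson_cdf.
  exact: measurable_funM.
have iQ n : P.-integrable setT (EFin \o Q n).
  apply: (@integrable_bounded _ _ _ _ _ 1) => // w.
  by case/andP: (Q01 n w) => a b; rewrite ger0_norm.
have EQ : \int[P]_w Q n w @[n --> \oo] --> survival alpha lambda t x.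
  have H := @cvg_surv_series R alpha (lambda * t) t x alpha01 y0 t0.
  rewrite -(cvg_shiftn N) in H.
  have {}H := cvgMr (a := expR (lambda `^ alpha * x)) H.
  apply: cvg_trans (H _); apply: near_eq_cvg; near=> n.
  rewrite /= (expectation_poisson_cdf mf f0 alpha01 lambda0 laplaceE)//.
  have -> : s n + lambda = (n + N).+1%:R / t by rewrite /s subrK.
  have -> // : s n / ((n + N).+1%:R / t) = 1 - lambda * t / (n + N).+1%:R.
  by rewrite /s mulrBl divff ?mulf_neq0 ?invr_eq0 ?(gt_eqF t0)// invf_div mulrA.
have Qlt w : f w < t -> Q n w @[n --> \oo] --> (1 : R).
  move=> ft; have := @cvg_poisson_lt R lambda t (f w) t0 (ltW lambda0).
  by rewrite f0 ft => /(_ isT); rewrite -(cvg_shiftn N).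
have Qgt w : t < f w -> Q n w @[n --> \oo] --> (0 : R).
  move=> ft; have := @cvg_poisson_gt R lambda t (f w) t0 (ltW lambda0) ft.
  by rewrite -(cvg_shiftn N).
pose A := [set w | f w < t]; pose B := [set w | t < f w].
have mA : measurable A.
  rewrite (_ : A = setT `&` f @^-1` `]-oo, t[%classic); last first.
    by rewrite setTI; apply/seteqP; split => w; rewrite /A /= in_itv.
  by apply: mf => //; exact: measurable_itv.
have mB : measurable B.
  rewrite (_ : B = setT `&` f @^-1` `]t, +oo[%classic); last first.
    by rewrite setTI; apply/seteqP; split => w; rewrite /B /= in_itv/= andbT.
  by apply: mf => //; exact: measurable_itv.
have EI C : measurable C -> \int[P]_w (\1_C w) = fine (P C).
  by move=> mC; rewrite /Rintegral integral_indic// setIT.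
have I01 (C : set T) w : 0 <= (\1_C w : R) <= 1.
  by rewrite indicE; case: (w \in C) => /=; rewrite ?lexx ?ler01.
have ABC : [set w | f w <= t] = ~` B.
  by apply/seteqP; split => w /=; rewrite leNgt => /negP.
have iI C : measurable C -> P.-integrable setT (EFin \o (\1_C : T -> R)).
  move=> mC; apply: (@integrable_bounded _ _ _ _ _ 1) => // w.
  by case/andP: (I01 C w) => a b; rewrite ger0_norm.
apply/andP; split.
  have H : \int[P]_w (\1_A w * Q n w) @[n --> \oo] --> \int[P]_w (\1_A w).
    apply: bounded_cvg_Rintegral => //.
    - by move=> n; apply: measurable_funM.
    - move=> n w; case/andP: (Q01 n w) => a b; case/andP: (I01 A w) => a' b'.
      by rewrite ger0_norm ?mulr_ge0// mulr_ile1.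
    - move=> w; rewrite indicE; case: (boolP (w \in A)) => [/set_mem wA|_] /=.
        by under eq_cvg do rewrite mul1r; exact: Qlt.
      by under eq_cvg do rewrite mul0r; exact: cvg_cst.
  rewrite -(EI A mA); apply: (ler_cvg_to H EQ).
  near=> n; apply: le_Rintegral => //.
    apply: (@integrable_bounded _ _ _ _ _ 1); first exact: measurable_funM.
    move=> w; case/andP: (Q01 n w) => a b; case/andP: (I01 A w) => a' b'.
    by rewrite ger0_norm ?mulr_ge0// mulr_ile1.
  by move=> w _; case/andP: (Q01 n w) => a b; case/andP: (I01 A w) => a' b'; rewrite ler_piMl.
have H : \int[P]_w (\1_B w * Q n w) @[n --> \oo] --> \int[P]_w (cst (0 : R) w).
  apply: bounded_cvg_Rintegral => //.
  - by move=> n; apply: measurable_funM.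
  - move=> n w; case/andP: (Q01 n w) => a b; case/andP: (I01 B w) => a' b'.
    by rewrite ger0_norm ?mulr_ge0// mulr_ile1.
  - move=> w; rewrite indicE; case: (boolP (w \in B)) => [/set_mem wB|_] /=.
      by under eq_cvg do rewrite mul1r; exact: Qgt.
    by under eq_cvg do rewrite mul0r; exact: cvg_cst.
have H' : fine (P (~` B)) + \int[P]_w (\1_B w * Q n w) @[n --> \oo] --> fine (P (~` B)).
  rewrite -[X in _ --> X]addr0; apply: cvgD; first exact: cvg_cst.
  by move: H; rewrite Rintegral_cst// mul0r.
rewrite ABC; apply: (ler_cvg_to EQ H').
near=> n; rewrite -EI; last exact: measurableC.
rewrite -RintegralD//; last 2 first.
- by apply: iI; exact: measurableC.
- apply: (@integrable_bounded _ _ _ _ _ 1); first exact: measurable_funM.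
  move=> w; case/andP: (Q01 n w) => a b; case/andP: (I01 B w) => a' b'.
  by rewrite ger0_norm ?mulr_ge0// mulr_ile1.
apply: le_Rintegral => //.
  apply: (@integrable_bounded _ _ _ _ _ 2).
    by apply: measurable_funD; [exact/measurable_indic/measurableC|exact: measurable_funM].
  move=> w; case/andP: (Q01 n w) => a b; case/andP: (I01 B w) => a' b'.
  case/andP: (I01 (~` B) w) => a2 b2.
  rewrite ger0_norm ?addr_ge0 ?mulr_ge0// (_ : 2 = 1 + 1 :> R)//.
  by rewrite lerD// mulr_ile1.
move=> w _; rewrite !indicE in_setC; case: (w \in B) => /=.
  by rewrite add0r mul1r.
by rewrite mul0r addr0; case/andP: (Q01 n w).
Unshelve. all: by end_near. Qed.
End Sandwich.

(** * From the tail of a distribution to its density *)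

Section DensityMeasure.
Context (R : realType) (h : R -> R).
Hypothesis mh : measurable_fun setT h.
Hypothesis h0 : forall x, 0 <= h x.

Definition density_measure (A : set R) : \bar R :=
  (\int[lebesgue_measure]_(x in A) (h x)%:E)%E.

Let dm0 : density_measure set0 = 0%E.
Proof. by rewrite /density_measure integral_set0. Qed.

Let dm_ge0 A : (0 <= density_measure A)%E.
Proof. by apply: integral_ge0 => x _; rewrite lee_fin. Qed.

Let dm_sigma_additive : semi_sigma_additive density_measure.
Proof.
move=> /= F mF tF mUF; rewrite /density_measure; apply: cvg_toP.
  apply: ereal_nondecreasing_is_cvgn => m n mn.
  apply: lee_sum_nneg_natr => // k _ _; apply: integral_ge0 => /= x Fkx.
  by rewrite lee_fin.
rewrite ge0_integral_bigcup//=.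
- by apply/measurable_funTS/measurableT_comp.
- by move=> x _; rewrite lee_fin.
Qed.

HB.instance Definition _ := isMeasure.Build _ _ _
  density_measure dm0 dm_ge0 dm_sigma_additive.

(** The half-lines are stable under intersection and generate the Borel sets. *)
Lemma density_of_tail d (T : measurableType d) (P : probability T R) (X : {RV P >-> R}) :
  (forall x, distribution P X `]x, +oo[%classic = density_measure `]x, +oo[%classic) ->
  is_density X h.
Proof.
move=> H; split => // A mA.
rewrite -/(density_measure A).
apply: (@g_sigma_algebra_measure_unique _ R _ (@RGenOInfty.G R) _ (fun n => `](- n%:R), +oo[%classic)
  _ _ (distribution P X) density_measure).
- by move=> _ [x ->]; exact: measurable_itv.
- by move=> n; exists (- n%:R).
- rewrite -subTset => x _; exists (Num.truncn `|x|).+1 => //=.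
  rewrite in_itv/= andbT ltrNl (le_lt_trans _ (truncnS_gt _))//.
  by rewrite -normrN ler_norm.
- move=> _ _ [x ->] [y ->]; exists (Num.max x y).
  apply/seteqP; split => z /=; rewrite !in_itv/= !andbT gt_max.
    by move=> [-> ->].
  by move=> /andP[-> ->].
- by move=> _ [x ->]; exact: H.
- by move=> n; rewrite (le_lt_trans (probability_le1 _ _))// ltry.
- have mA' : @measurable _ (measurableTypeR R) A := mA.
  by move: mA'; rewrite RGenOInfty.measurableE.
Qed.

End DensityMeasure.

Section SurvivalDerivative.
Context (R : realType) (alpha lambda t : R).
Hypothesis alpha01 : 0 < alpha < 1.
Hypothesis lambda0 : 0 < lambda.
Hypothesis t0 : 0 < t.

Let y := lambda * t.
Let y0 : 0 < y. Proof. exact: mulr_gt0. Qed.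
Let a := surv_coef alpha y t.
Let ea : entire a. Proof. exact: entire_surv_coef. Qed.

Definition density_term (x : R) (k : nat) : R :=
  expR (- lambda * t + lambda `^ alpha * x)
  * ((- x) ^+ k * t `^ (- alpha * k.+1%:R) / k`!%:R)
  * limn (series (its_inner_term alpha lambda t k)).

Definition density_series (x : R) : R := limn (series (density_term x)).

Lemma its_inner_termE k m : its_inner_term alpha lambda t k m =
  y ^+ m * recip_Gamma (1 - alpha * k.+1%:R + m%:R)
  - y `^ alpha * (y ^+ m * recip_Gamma (1 - alpha * k%:R + m%:R)).
Proof.
rewrite /its_inner_term /y [lambda * t]mulrC.
have -> : t `^ (alpha + m%:R) * lambda `^ (alpha + m%:R) = (t * lambda) `^ alpha * (t * lambda) ^+ m.
  by rewrite -powRM ?(ltW t0) ?(ltW lambda0)// -powR_mulrn ?mulr_ge0 ?(ltW t0) ?(ltW lambda0)//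
    -powRD// ?(gt_eqF (mulr_gt0 t0 lambda0)) ?implybT.
rewrite -!mulrA; congr (_ * recip_Gamma _ - _ * (_ * recip_Gamma _)); ring.
Qed.

Lemma cvg_inner k : series (its_inner_term alpha lambda t k) @ \oo -->
  inner_sum y (alpha * k.+1%:R) - y `^ alpha * inner_sum y (alpha * k%:R).
Proof.
have [c1 _] := cvg_inner_sum (alpha * k.+1%:R) (ltW y0).
have [c2 _] := cvg_inner_sum (alpha * k%:R) (ltW y0).
set u := (fun m => y ^+ m * _) in c1; set v := (fun m => y ^+ m * _) in c2.
have H : series u N - y `^ alpha * series v N @[N --> \oo] -->
    inner_sum y (alpha * k.+1%:R) - y `^ alpha * inner_sum y (alpha * k%:R).
  by apply: cvgB => //; exact: cvgMr.
apply: cvg_trans H; apply: near_eq_cvg; near=> N.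
rewrite /series/= mulr_sumr -sumrB; apply: eq_bigr => m _.
by rewrite its_inner_termE.
Unshelve. all: by end_near. Qed.

(** The bracket of the k-th term splits: inner_sum at alpha (k + 1) gives the
    k-th coefficient of the derivative of the power series in [survival], and
    (lambda t)^alpha inner_sum at alpha k gives lambda^alpha a_k, the
    contribution of the exponential factor. *)
Lemma density_termE x k : density_term x k =
  expR (lambda `^ alpha * x) *
  (- (lambda `^ alpha * (a k * x ^+ k) + pseries_diffs a k * x ^+ k)).
Proof.
rewrite /density_term (cvg_lim _ (@cvg_inner k))//.
rewrite addrC expRD /pseries_diffs /a /surv_coef -/y.
have -> : expR (- lambda * t) = expR (- y) by rewrite mulNr.
have -> : t `^ (- alpha * k.+1%:R) = t `^ (- (alpha * k.+1%:R)) by rewrite mulNr.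
have -> : y `^ alpha = lambda `^ alpha * t `^ alpha.
  by rewrite powRM ?(ltW t0) ?(ltW lambda0).
have -> : t `^ (- (alpha * k%:R)) = t `^ (- (alpha * k.+1%:R)) * t `^ alpha.
  by rewrite -powRD ?(gt_eqF t0) ?implybT//; congr (_ `^ _); rewrite -natr1; ring.
rewrite factS natrM exprS [(- x) ^+ k]exprNn.
have f0 : k`!%:R != 0 :> R by rewrite pnatr_eq0 -lt0n fact_gt0.
have k0 : k.+1%:R != 0 :> R by [].
move: (k`!%:R : R) f0 => f f0; move: (inner_sum _ _) => i1.
move: (inner_sum _ _) => i2; move: (t `^ _) => T1; move: (t `^ _) => T2.
move: (expR (- y)) (expR _) (lambda `^ alpha) => e1 e2 l.
move: (k.+1%:R : R) k0 => K k0.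
by field; rewrite f0 k0.
Qed.

Lemma cvg_density_series x : series (density_term x) @ \oo --> density_series x /\
  density_series x = - (lambda `^ alpha * survival alpha lambda t x
    + expR (lambda `^ alpha * x) * limn (pseries (pseries_diffs a) x)).
Proof.
have c1 := @entire_cvg _ a x ea.
have c2 := @entire_cvg _ _ x (entire_diffs ea).
have H : series (density_term x) @ \oo --> expR (lambda `^ alpha * x) *
   (- (lambda `^ alpha * limn (pseries a x) + limn (pseries (pseries_diffs a) x))).
  have : expR (lambda `^ alpha * x) *
   (- (lambda `^ alpha * pseries a x N + pseries (pseries_diffs a) x N)) @[N --> \oo] -->
   expR (lambda `^ alpha * x) *
   (- (lambda `^ alpha * limn (pseries a x) + limn (pseries (pseries_diffs a) x))).
    by apply: cvgMr; apply: cvgN; apply: cvgD => //; exact: cvgMr.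
  apply: cvg_trans; apply: near_eq_cvg; near=> N.
  rewrite /pseries/series/= mulr_sumr -big_split/= -sumrN mulr_sumr.
  by apply: eq_bigr => k _; rewrite density_termE.
split; first by rewrite /density_series (cvg_lim _ H).
rewrite /density_series (cvg_lim _ H)// /survival -/y -/a; ring.
Unshelve. all: by end_near. Qed.

Lemma is_derive_survival x :
  is_derive x (1 : R) (survival alpha lambda t) (- density_series x).
Proof.
have [_ ->] := cvg_density_series x.
have d1 := entire_derive x ea.
rewrite /survival -/y -/a; apply: is_derive_eq.
by rewrite /GRing.scale/= mulr1; ring.
Qed.

Lemma continuous_density_series : continuous density_series.
Proof.
move=> x.
have -> : density_series = fun x => - (lambda `^ alpha * survival alpha lambda t x
    + expR (lambda `^ alpha * x) * limn (pseries (pseries_diffs a) x)).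
  by apply/funext => z; have [] := cvg_density_series z.
apply: differentiable_continuous; apply/derivable1_diffP.
have d1 := is_derive_survival x.
have d2 := entire_derive x (entire_diffs ea).
by [].
Qed.

(** Only k = 0 contributes, and inner_sum y 0 = exp y. *)
Lemma survival0 : survival alpha lambda t 0 = 1.
Proof.
rewrite /survival mulr0 expR0 mul1r -/y -/a.
apply/cvg_lim => //.
have : (a 0 : R) @[N --> \oo] --> (1 : R).
  rewrite /a /surv_coef expr0 fact0 divr1 mul1r !mulr0 oppr0 powRr0 mul1r.
  by rewrite inner_sum0 ?(ltW y0)// -expRD addNr expR0; exact: cvg_cst.
rewrite -[X in _ -> X](cvg_shiftS (pseries a 0)).
apply: cvg_trans; apply: near_eq_cvg; near=> N.
rewrite /pseries/series/= big_nat_recl//= expr0 mulr1 big1 ?addr0// => k _.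
by rewrite exprS mul0r mulr0.
Unshelve. all: by end_near. Qed.

End SurvivalDerivative.

(** * The inverse subordinator *)

Section TailToDensity.
Context (R : realType) d (T : measurableType d) (P : probability T R) (E : {RV P >-> R}).
Variables (S hs : R -> R).
Hypothesis tailE : forall x, 0 <= x -> distribution P E `]x, +oo[%classic = (S x)%:E.
Hypothesis S0 : S 0 = 1.
Hypothesis dS : forall x, is_derive x (1 : R) S (- hs x).
Hypothesis chs : continuous hs.

Let S_noninc x y : 0 <= x -> x <= y -> S y <= S x.
Proof.
move=> x0 xy; rewrite -lee_fin -!tailE//; last exact: le_trans xy.
apply: le_measure; rewrite ?inE; [exact: measurable_itv|exact: measurable_itv|].
by move=> z; rewrite /= !in_itv/= !andbT; exact: le_lt_trans.
Qed.

Let hs_ge0_pos x : 0 < x -> 0 <= hs x.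
Proof.
move=> x0; apply/ler_addgt0Pr => e e0; rewrite -lerBlDl sub0r.
(* The tilt makes the nonincreasing S strictly decreasing. *)
pose f z := S z - e * z.
have df z : is_derive z (1 : R) f (- hs z - e).
  by have d1 := dS z; apply: is_derive_eq; rewrite /GRing.scale/= mulr1.
have : (f^`())%classic x <= 0.
  apply: (@decr_derive1_le0_itvy R f true 0); last by rewrite in_itv/= x0.
    by move=> z _; have [] := df z.
  move=> u v; rewrite !in_itv/= !andbT => u0 v0 vu.
  rewrite /f; have := S_noninc v0 (ltW vu).
  have : e * v < e * u by rewrite ltr_pM2l.
  lra.
rewrite derive1E; have [_ ->] := df x; lra.
Qed.

Let hs_ge0 x : 0 <= x -> 0 <= hs x.
Proof.
rewrite le_eqVlt => /predU1P[<-|]; last exact: hs_ge0_pos.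
have H : hs (n.+1%:R^-1) @[n --> \oo] --> hs 0.
  by apply: (cvg_comp (fun n => n.+1%:R^-1) hs); [exact: cvg_harmonic|exact: chs].
rewrite -(cvg_lim _ H)//; apply: limr_ge; first by apply/cvg_ex; eexists; exact: H.
by near=> n; apply: hs_ge0_pos; rewrite invr_gt0.
Unshelve. all: by end_near. Qed.

Let S_cvg0 : - S x @[x --> +oo] --> (0 : R).
Proof.
rewrite -oppr0; apply: cvgN.
have H := cvg_ccdfy0 E.
have : fine (ccdf E x) @[x --> +oo] --> fine (0%E : \bar R) by exact: fine_cvg.
apply: cvg_trans; apply: near_eq_cvg; near=> x.
by rewrite /ccdf tailE.
Unshelve. all: by end_near. Qed.

(** E is nonnegative, so its density is set to 0 off the positive half-line. *)
Definition half_line_density : R -> R := hs \_ `]0, +oo[%classic.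

(** On a half-line the integral of hs is recovered by the fundamental theorem
    from - S, which tends to 0 at infinity because S is the tail of a real
    random variable. Levels x < 0 reduce to 0, since S 0 = 1. *)
Lemma density_of_survival : is_density E half_line_density.
Proof.
have mhs : measurable_fun setT hs by exact: continuous_measurable_fun.
have mh : measurable_fun setT half_line_density.
  apply/(measurable_restrictT _ _).1; first exact: measurable_itv.
  exact: measurable_funTS.
have h0 x : 0 <= half_line_density x.
  rewrite /half_line_density patchE; case: ifPn => // /set_mem/=.
  by rewrite in_itv/= andbT => /hs_ge0_pos.
apply: density_of_tail => // x.
pose m := Num.max x 0.
have m0 : 0 <= m by rewrite le_max lexx orbT.
have -> : distribution P E `]x, +oo[%classic = distribution P E `]m, +oo[%classic.
  have [x0|x0] := leP 0 x; first by rewrite /m max_l.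
  rewrite /m max_r ?(ltW x0)// (tailE (lexx 0)) S0; apply/eqP; rewrite eq_le probability_le1.
    have := tailE (lexx 0); rewrite S0 => <-; apply: le_measure; rewrite ?inE.
    - exact: measurable_itv.
    - exact: measurable_itv.
    - by move=> z; rewrite /= !in_itv/= !andbT; exact: lt_trans.
  exact: measurable_itv.
rewrite tailE// /density_measure.
under eq_integral do rewrite -[(_ _)%:E]/((EFin \o half_line_density) _).
rewrite /half_line_density -restrict_EFin -integral_mkcondr.
have -> : `]x, +oo[%classic `&` `]0, +oo[%classic = `]m, +oo[%classic :> set R.
  apply/seteqP; split => z /=; rewrite !in_itv/= !andbT gt_max.
    by move=> [-> ->].
  by move=> /andP[-> ->].
rewrite integral_itv_obnd_cbnd; last first.
  by apply: measurable_funTS; exact/measurable_EFinP.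
rewrite (@ge0_continuous_FTC2y R hs (fun x => - S x) m 0).
- by rewrite EFinN oppeK add0e.
- by move=> z mz; apply: hs_ge0; exact: le_trans mz.
- exact: continuous_subspaceT.
- exact: S_cvg0.
- by move=> z _; apply: derivableN; have [] := dS z.
- apply: cvg_at_right_filter; apply: cvgN.
  by apply: differentiable_continuous; apply/derivable1_diffP; have [] := dS m.
- move=> z _; rewrite derive1E deriveN; last by have [] := dS z.
  by have [_ ->] := dS z; rewrite opprK.
Qed.

End TailToDensity.

Section InverseTail.
Context (R : realType) d (T : measurableType d) (P : probability T R).

Lemma ae_le_measure (A B : set T) : measurable A -> measurable B ->
  {ae P, forall w, A w -> B w} -> (P A <= P B)%E.
Proof.
move=> mA mB [N [mN N0 sN]].
rewrite -(measureU0 mB mN N0); apply: le_measure; rewrite ?inE//.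
  exact: measurableU.
move=> w Aw; have [Bw|nBw] := pselect (B w); [by left|right].
by apply: sN => /= H; apply: nBw; exact: H.
Qed.

Variables (alpha lambda : R) (D : R -> {RV P >-> R}).
Hypothesis alpha01 : 0 < alpha < 1.
Hypothesis lambda0 : 0 < lambda.
Hypothesis hD : tempered_stable_subordinator alpha lambda D.

Lemma ae_path : {ae P, forall w, D 0 w = 0 /\
  forall u v, 0 <= u -> u <= v -> D u w <= D v w}.
Proof.
have [[H1 _ _ H2 _] _] := hD.
by apply: filterS2 H1 H2 => w h1 h2; split.
Qed.

(** D u is nonnegative only almost surely; its absolute value has the same law
    and satisfies the sign hypothesis of [survival_sandwich] everywhere. *)
Lemma laplace_moment_norm u s : 0 <= u -> 0 < s ->
  laplace_moment P (fun w => `|D u w|) 0 s =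
  expR (- u * ((s + lambda) `^ alpha - lambda `^ alpha)).
Proof.
move=> u0 s0; have [_ /(_ u s u0 s0)] := hD.
rewrite unlock /laplace_moment /Rintegral => H.
rewrite -[RHS]/(fine (expR (- u * ((s + lambda) `^ alpha - lambda `^ alpha)))%:E) -H.
congr fine; apply: ae_eq_integral => //.
- apply/measurable_EFinP; apply: measurable_laplace_kernel.
  exact: measurableT_comp.
- by apply/measurable_EFinP; apply: measurableT_comp => //; exact: measurable_funM.
apply: filterS ae_path => w [h1 h2] _.
have := h2 0 u (lexx _) u0; rewrite h1 => Du.
by rewrite /laplace_kernel expr0 mul1r ger0_norm.
Qed.

Lemma measurable_normD u : measurable_fun setT (fun w => `|D u w|).
Proof. exact: measurableT_comp. Qed.

Lemma measurable_preim (f : T -> R) (B : set R) : measurable_fun setT f ->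
  measurable B -> measurable [set w | B (f w)].
Proof. by move=> mf mB; rewrite -[X in measurable X]setTI; exact: mf. Qed.

Lemma measurable_eq (f : T -> R) r : measurable_fun setT f ->
  measurable [set w | f w = r].
Proof. by move=> mf; apply: (@measurable_preim f [set r]). Qed.

Lemma measurable_le (f : T -> R) r : measurable_fun setT f ->
  measurable [set w | f w <= r].
Proof.
move=> mf; have := measurable_preim mf (measurable_itv `]-oo, r]).
by congr measurable; apply/seteqP; split => w /=; rewrite in_itv.
Qed.

Lemma measurable_lt (f : T -> R) r : measurable_fun setT f ->
  measurable [set w | f w < r].
Proof.
move=> mf; have := measurable_preim mf (measurable_itv `]-oo, r[).
by congr measurable; apply/seteqP; split => w /=; rewrite in_itv.
Qed.

(** The mass p of D u at 0 bounds the Laplace transform from below at every s,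
    and the transform tends to 0 at infinity because (s + lambda)^alpha is
    unbounded. *)
Lemma tempered_neq0 u : 0 < u -> P [set w | D u w = 0] = 0%E.
Proof.
move=> u0.
have mZ : measurable [set w | D u w = 0] by exact: measurable_eq.
set p := fine (P [set w | D u w = 0]).
suff p0 : p = 0.
  by rewrite -[LHS]fineK ?fin_num_measure// -/p p0.
have pge0 : 0 <= p by rewrite fine_ge0.
have bound s : 0 < s -> p <= expR (- u * ((s + lambda) `^ alpha - lambda `^ alpha)).
  move=> s0; rewrite -laplace_moment_norm ?(ltW u0)//.
  have -> : p = \int[P]_w (\1_[set w | D u w = 0] w).
    by rewrite /Rintegral integral_indic// setIT.
  apply: le_Rintegral => //.
  - apply: (@integrable_bounded _ _ _ _ _ 1) => //.
    by move=> w; rewrite indicE; case: (_ \in _) => /=; rewrite ?normr1 ?normr0.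
  - by apply: integrable_laplace_kernel => //; exact: measurable_normD.
  - move=> w _; rewrite indicE /laplace_kernel expr0 mul1r.
    case: (boolP (w \in _)) => [/set_mem/= ->|_] /=; last exact: expR_ge0.
    by rewrite normr0 mulr0 expR0.
apply/eqP; rewrite eq_le pge0 andbT leNgt; apply/negP => p0.
(* At s = M^(1 / alpha) the transform is at most exp (- 1 / p), and
   exp (1 / p) > 1 / p. *)
pose M := lambda `^ alpha + (u * p)^-1.
have up0 : 0 < (u * p)^-1 by rewrite invr_gt0 mulr_gt0.
have M0 : 0 < M by rewrite ltr_pwDr ?powR_ge0.
have [a0 a1] := andP alpha01.
have s0 : 0 < M `^ alpha^-1 by rewrite powR_gt0.
have := bound _ s0; apply/negP; rewrite -ltNge.
have H : (u * p)^-1 <= (M `^ alpha^-1 + lambda) `^ alpha - lambda `^ alpha.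
  rewrite lerBrDl -/M.
  rewrite -[leLHS](powRr1 (ltW M0)) -(mulVf (lt0r_neq0 a0)) powRrM.
  rewrite ge0_ler_powR ?nnegrE ?powR_ge0 ?(ltW a0)//.
    by rewrite addr_ge0 ?powR_ge0// ltW.
  by rewrite lerDl ltW.
apply: (@le_lt_trans _ _ (expR (- p^-1))).
  rewrite ler_expR mulNr lerN2; apply: le_trans (ler_wpM2l (ltW u0) H).
  by rewrite invfM mulrA mulfV ?gt_eqF// mul1r.
rewrite expRN -[ltRHS]invrK ltf_pV2 ?posrE ?expR_gt0 ?invr_gt0//.
by apply: lt_le_trans (expR_ge1Dx _); rewrite ltrDr.
Qed.

(** By stationarity; it says that paths are almost surely strictly increasing
    between two given times. *)
Lemma tempered_increment_neq0 u v : 0 <= u -> u < v ->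
  P [set w | D v w - D u w = 0] = 0%E.
Proof.
move=> u0 uv; have [[_ H _ _ _] _] := hD.
have vu : 0 < v - u by rewrite subr_gt0.
have := H u (v - u) [set 0] u0 (ltW vu) (measurable_set1 _).
rewrite subrKC => ->.
apply/eqP; rewrite eq_le measure_ge0 andbT -(tempered_neq0 vu).
apply: ae_le_measure.
- by apply: measurable_eq; exact: measurable_funB.
- exact: measurable_eq.
- by apply: filterS ae_path => w [h1 _] /=; rewrite h1 subr0.
Qed.

Variables (t : R) (E : {RV P >-> R}).
Hypothesis t0 : 0 < t.
Hypothesis hE : inverse_at D t E.

(** The path stays at or below t up to time u, so it cannot pass t before u. *)
Lemma tail_ge u x : x < u -> 0 < u ->
  (P [set w | (`|D u w| <= t)%R] <= distribution P E `]x, +oo[%classic)%E.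
Proof.
move=> xu u0; apply: ae_le_measure.
- exact: measurable_le (measurable_normD u).
- exact: measurable_preim.
apply: filterS2 ae_path hE => w [h1 h2] hw /= Dt.
have Du : D u w <= t by apply: le_trans Dt; exact: ler_norm.
rewrite in_itv/= andbT -lte_fin hw; apply: (@lt_le_trans _ _ u%:E).
  by rewrite lte_fin.
apply: le_ereal_inf_tmp => _ [v [v0 tv] <-]; rewrite lee_fin leNgt; apply/negP => vu.
by have := h2 v u (ltW v0) (ltW vu); lra.
Qed.

(** Before E the path has not passed t, so D x <= t. Strictness at the earlier
    time u comes from [tempered_increment_neq0]. *)
Lemma tail_le u x : 0 <= u -> u < x ->
  (distribution P E `]x, +oo[%classic <= P [set w | (`|D u w| < t)%R])%E.
Proof.
move=> u0 ux.
pose Z := [set w | D x w - D u w = 0].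
have mZ : measurable Z by apply: measurable_eq; exact: measurable_funB.
have mL := measurable_lt t (measurable_normD u).
rewrite -(measureU0 mL mZ (tempered_increment_neq0 u0 ux)).
apply: ae_le_measure.
- exact: measurable_preim.
- exact: measurableU.
apply: filterS2 ae_path hE => w [h1 h2] hw /=.
rewrite in_itv/= andbT -lte_fin hw => xE.
have x0 : 0 < x by exact: le_lt_trans ux.
have Dx : D x w <= t.
  rewrite leNgt; apply/negP => tD; move: xE; rewrite ltNge => /negP; apply.
  by apply: ge_ereal_inf; exists x%:E => //; exists x.
have Dux := h2 u x u0 (ltW ux).
have D0 := h2 0 u (lexx _) u0; rewrite h1 in D0.
have [e|ne] := eqVneq (D x w) (D u w); first by right; rewrite /Z /= e subrr.
left; rewrite ger0_norm//; apply: lt_le_trans Dx.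
by rewrite lt_neqAle Dux eq_sym ne.
Qed.

Lemma cvg_survival x (u : nat -> R) : u n @[n --> \oo] --> x ->
  survival alpha lambda t (u n) @[n --> \oo] --> survival alpha lambda t x.
Proof.
move=> ux; apply: (cvg_comp u (survival alpha lambda t) ux).
apply: differentiable_continuous; apply/derivable1_diffP.
by have [] := is_derive_survival alpha01 lambda0 t0 x.
Qed.

(** Squeeze with u = x + 1 / (n + 1) and u = x - x / (n + 1), which remains
    nonnegative. At x = 0 no smaller time is available, and survival 0 = 1 gives
    the upper bound. *)
Lemma tail_survival x : 0 <= x ->
  distribution P E `]x, +oo[%classic = (survival alpha lambda t x)%:E.
Proof.
move=> x0.
have fE : distribution P E `]x, +oo[%classic \is a fin_num.
  by apply: fin_num_measure; exact: measurable_itv.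
rewrite -[LHS]fineK//; congr EFin.
have sw u (u0 : 0 <= u) := survival_sandwich (measurable_normD u)
  (fun w => normr_ge0 _) alpha01 lambda0 (fun s s0 => laplace_moment_norm u0 s0) t0.
have mle u := measurable_le t (measurable_normD u).
have mlt u := measurable_lt t (measurable_normD u).
apply/eqP; rewrite eq_le; apply/andP; split.
  have [->|xn0] := eqVneq x 0.
    rewrite survival0// -lee_fin fineK; first exact: probability_le1.
    by rewrite fin_num_measure//; exact: measurable_itv.
  have xgt0 : 0 < x by rewrite lt_neqAle eq_sym xn0.
  have H : survival alpha lambda t (x - x * n.+1%:R^-1) @[n --> \oo] --> survival alpha lambda t x.
    apply: cvg_survival; rewrite -[X in _ --> X]subr0; apply: cvgB; first exact: cvg_cst.
    by rewrite -(mulr0 x); apply: cvgMr; exact: cvg_harmonic.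
  rewrite -(cvg_lim _ H)//; apply: limr_ge; first by apply/cvg_ex; eexists; exact: H.
  near=> n.
  have u0 : 0 <= x - x * n.+1%:R^-1.
    by rewrite subr_ge0 ler_piMr// invf_le1// ler1n.
  have ux : x - x * n.+1%:R^-1 < x by rewrite gtrBl mulr_gt0 ?invr_gt0.
  case/andP: (sw _ u0) => + _; apply: le_trans.
  by rewrite fine_le ?fin_num_measure//; exact: tail_le.
have H : survival alpha lambda t (x + n.+1%:R^-1) @[n --> \oo] --> survival alpha lambda t x.
  apply: cvg_survival; rewrite -[X in _ --> X]addr0; apply: cvgD; first exact: cvg_cst.
  exact: cvg_harmonic.
rewrite -(cvg_lim _ H)//; apply: limr_le; first by apply/cvg_ex; eexists; exact: H.
near=> n.
have u0 : 0 < x + n.+1%:R^-1 by rewrite ltr_wpDl ?invr_gt0.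
have xu : x < x + n.+1%:R^-1 by rewrite ltrDl invr_gt0.
case/andP: (sw _ (ltW u0)) => _ /le_trans; apply.
by rewrite fine_le ?fin_num_measure//; exact: tail_ge.
Unshelve. all: by end_near. Qed.

End InverseTail.

Theorem proposition4p2 (R : realType) (d : measure_display)
    (T : measurableType d) (P : probability T R) (alpha lambda t : R)
    (D : R -> {RV P >-> R}) (E : {RV P >-> R})
    (halpha0 : 0 < alpha) (halpha1 : alpha < 1)
    (hlambda : 0 < lambda) (ht : 0 < t)
    (hD : tempered_stable_subordinator alpha lambda D)
    (hE : inverse_at D t E) :
  exists h : R -> R,
    [/\ is_density E h,
        forall k : nat, cvgn (series (its_inner_term alpha lambda t k)) &
        forall x : R, 0 < x ->
          series (fun k : nat =>
            expR (- lambda * t + lambda `^ alpha * x)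
            * ((- x) ^+ k * t `^ (- alpha * k.+1%:R) / k`!%:R)
            * limn (series (its_inner_term alpha lambda t k)))
          @ \oo --> h x].
Proof.
have alpha01 : 0 < alpha < 1 by rewrite halpha0.
exists (half_line_density (density_series alpha lambda t)); split.
- apply: (@density_of_survival _ _ _ _ _ (survival alpha lambda t)).
  + by move=> x x0; apply: (tail_survival alpha01 hlambda hD ht hE x0).
  + exact: survival0.
  + by move=> x; exact: is_derive_survival.
  + exact: continuous_density_series.
- by move=> k; apply/cvg_ex; eexists; exact: cvg_inner.
- move=> x x0; rewrite /half_line_density patchE ifT; last first.
    by rewrite inE/= in_itv/= x0.
  by have [] := cvg_density_series alpha01 hlambda ht x.
Qed.
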